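(* For any skew shape $S$, the number of binary fillings of $S$ that avoid $\delta_2$ is the same as the number of binary fillings of $S$ that avoid both $\iota_2$ and $\phi_{\mathrm{D}}$. Moreover, there is a bijection between these two sets of fillings that preserves the number of 1-cells in every row.
   Context: A cell is a unit square with vertices in $\mathbb{Z}^2$; its coordinates are those of its top-right corner, so cell $(i,j)$ is the cell in column $i$ and row $j$ (columns numbered left to right, rows numbered bottom to top). A shape is a finite union of cells; shapes are considered up to translation and, unless stated otherwise, a nonempty shape is placed so that its leftmost cell has column coordinate $1$ and its bottommost cell has row coordinate $1$. The height (width) of a shape is the row coordinate of its topmost cell (the column coordinate of its rightmost cell). A NW Ferrers shape is a top-left justified Young-diagram shape: every row is a contiguous run of cells, every column is a contiguous run of cells, all rows have their leftmost cell in the same column, and all columns have their topmost cell in the same row. A skew shape is a shape of the form $S=F_1\setminus F_2$ (the cells of $F_1$ not belonging to $F_2$), where $F_1$ and $F_2$ are NW Ferrers shapes with the same top-left cell ($F_2$ may be empty). Containment of shapes: a shape $S$ of height $h$ and width $w$ contains a shape $T$ of height $k$ and width $\ell$ if there are row indices $1\le r_1<\dots<r_k\le h$ and column indices $1\le c_1<\dots<c_\ell\le w$ such that for all $1\le i\le \ell$, $1\le j\le k$, the cell $(i,j)$ belongs to $T$ if and only if the cell $(c_i,r_j)$ belongs to $S$. Such rows and columns form an occurrence of $T$ in $S$. A binary filling of a shape is a function assigning a value in $\{0,1\}$ to each cell; a 1-cell is a cell with value $1$. A filling $\phi_S$ of $S$ contains a filling $\phi_T$ of $T$ if there is an occurrence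 of $T$ in $S$, in rows $r_1<\dots<r_k$ and columns $c_1<\dots<c_\ell$, such that $\phi_T(i,j)\le\phi_S(c_i,r_j)$ for every cell $(i,j)$ of $T$; otherwise $\phi_S$ avoids $\phi_T$. $\iota_2$ is the filling of the $2\times2$ square shape with 1-cells $(1,1),(2,2)$, and $\delta_2$ is the filling of the $2\times 2$ square shape with 1-cells $(1,2),(2,1)$ (other cells have value $0$). $\mathrm{D}$ is the skew shape obtained from the $3\times3$ square $\{(i,j):1\le i,j\le 3\}$ by removing the top-left cell $(1,3)$ and the bottom-right cell $(3,1)$, and $\phi_{\mathrm{D}}$ is the binary filling of $\mathrm{D}$ whose 1-cells are exactly $(1,1)$, $(2,3)$, $(3,2)$. *)

(* Defs.v *)
From HB Require Import structures.
From mathcomp Require Import all_boot all_order all_algebra finmap.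

Set Implicit Arguments.
Unset Strict Implicit.
Unset Printing Implicit Defensive.

Import Order.TTheory GRing.Theory Num.Theory.
Local Open Scope fset_scope.
Local Open Scope ring_scope.

(* (i, j) is the cell in column i (left to right) and row j (bottom to top). *)
Definition cell := (int * int)%type.
Definition cell_shape := {fset cell}.

Definition standard_position (S : cell_shape) : Prop :=
  (forall i j : int, (i, j) \in S -> 1 <= i /\ 1 <= j) /\
  (S != fset0 -> (exists j, (1, j) \in S) /\ (exists i, (i, 1) \in S)).

(* For shapes in standard position only: the absolute values then merely
   convert positive coordinates to nat.  Both are 0 for the empty shape. *)
Definition width (S : cell_shape) : nat := \max_(x <- S) `|x.1|%N.
Definition height (S : cell_shape) : nat := \max_(x <- S) `|x.2|%N.

Definition row_convex (F : cell_shape) : Prop :=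
  forall i1 i i2 j : int, i1 <= i <= i2 ->
    (i1, j) \in F -> (i2, j) \in F -> (i, j) \in F.

Definition column_convex (F : cell_shape) : Prop :=
  forall i j1 j j2 : int, j1 <= j <= j2 ->
    (i, j1) \in F -> (i, j2) \in F -> (i, j) \in F.

(* If F is nonempty, (a, b) is its top-left cell; the empty shape is accepted
   with every (a, b). *)
Definition NW_Ferrers (a b : int) (F : cell_shape) : Prop :=
  [/\ row_convex F,
      column_convex F,
      forall i j : int, (i, j) \in F -> a <= i /\ (a, j) \in F
    & forall i j : int, (i, j) \in F -> j <= b /\ (i, b) \in F].

Definition skew_shape (S : cell_shape) : Prop :=
  exists (a b : int) (F1 F2 : cell_shape),
    [/\ NW_Ferrers a b F1, NW_Ferrers a b F2 & S = F1 `\` F2].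

(* Ordinals count from 0, coordinates from 1. *)
Definition cell_of (w h : nat) (i : 'I_w) (j : 'I_h) : cell :=
  (i.+1%:Z, j.+1%:Z).

Definition increasing (m n : nat) (f : {ffun 'I_m -> 'I_n}) : bool :=
  [forall i : 'I_m, forall i' : 'I_m, (i < i')%N ==> (f i < f i')%N].

Definition occurrence (S T : cell_shape)
    (c : {ffun 'I_(width T) -> 'I_(width S)})
    (r : {ffun 'I_(height T) -> 'I_(height S)}) : bool :=
  [&& increasing c, increasing r &
    [forall i, forall j,
      (cell_of i j \in T) == (cell_of (c i) (r j) \in S)]].

Definition filling (S : cell_shape) := {ffun S -> bool}.

(* The value false outside S is a dummy: below, value is only evaluated on
   cells of the shape. *)
Definition value (S : cell_shape) (phi : filling S) (x : cell) : bool :=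
  if insub x is Some y then phi y else false.

Definition contains (S T : cell_shape) (phi : filling S) (psi : filling T) : bool :=
  [exists c, exists r, @occurrence S T c r &&
    [forall i, forall j, (cell_of i j \in T) ==>
      (value psi (cell_of i j) <= value phi (cell_of (c i) (r j)))%N]].

Definition avoids (S T : cell_shape) (phi : filling S) (psi : filling T) : bool :=
  ~~ contains phi psi.

Definition ones_in_row (S : cell_shape) (phi : filling S) (j : int) : nat :=
  #|[set x : S | phi x && ((val x).2 == j)]|.

Definition square (n : nat) : cell_shape :=
  [fset (i%:Z, j%:Z) | i in iota 1 n, j in iota 1 n].

Definition filling_of_ones (S : cell_shape) (s : seq cell) : filling S :=
  [ffun x : S => val x \in s].

Definition iota2 : filling (square 2) :=
  filling_of_ones (square 2) [:: (1, 1); (2, 2)].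

Definition delta2 : filling (square 2) :=
  filling_of_ones (square 2) [:: (1, 2); (2, 1)].

Definition shapeD : cell_shape := square 3 `\` [fset (1, 3); (3, 1)].

Definition phiD : filling shapeD :=
  filling_of_ones shapeD [:: (1, 1); (2, 3); (3, 2)].

(* Main.v *)
(* Row [j] of a skew shape is an interval [l j, r j) of columns, with [l] and [r]
   weakly increasing upwards.  Fixing the number of 1-cells of every row, it is
   enough to show that the two classes have equally many fillings; this is done
   by induction on the number of 1-cells and on the size of the shape.

   Suppose that some row i is strictly longer to the right than all the
   nonempty rows below it, and let q = (c, i) be its last cell, so that removing
   q leaves a skew shape.  For delta_2 the avoiders with a 0 in q are those of
   the smaller shape, and an avoider with a 1 in q splits into the rows from i
   upwards and the rows below i, which interact only through the set M of
   columns left of c that contain a 1 in the upper part.  For the other class,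
   the avoiders with a 0 in q are the avoiders of the smaller shape that are not
   "straddled", and both the straddled ones and those with a 1 in q split in the
   same way, again interacting only through M.  Hence the two recursions agree
   as soon as the upper parts with a given M satisfy
      #(1 in q) = #(straddled) + #(delta_2-avoiding, 1 in q).
   Summed over all M inside a set K of columns, this is the theorem for the
   upper part with its columns left of c restricted to K; since K is arbitrary,
   it holds for each M.  This is why all counts carry a set C of allowed columns.

   If no such row exists, all nonempty rows end in the same column.  Then the
   top row, with set X of 1-cells, forbids to the rows below it the columns of
   its range before max X (respectively after min X), and an order reversal of
   the columns exchanges the two cases. *)

Require Import Defs.
From mathcomp Require Import all_boot all_order all_algebra finmap.
From mathcomp Require Import zify.

Set Implicit Arguments.
Unset Strict Implicit.
Unset Printing Implicit Defensive.

(** * Counting in finite sets *)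

Lemma card_can_in (T U : finType) (A : {set T}) (B : {set U})
    (f : T -> U) (g : U -> T) :
  {in A, forall x, f x \in B} -> {in B, forall y, g y \in A} ->
  {in A, cancel f g} -> {in B, cancel g f} -> #|A| = #|B|.
Proof.
move=> fAB gBA fK gK; apply/eqP; rewrite eqn_leq; apply/andP; split.
  rewrite -(card_in_imset (can_in_inj fK)); apply/subset_leq_card/subsetP.
  by move=> _ /imsetP [x xA ->]; apply: fAB.
rewrite -(card_in_imset (can_in_inj gK)); apply/subset_leq_card/subsetP.
by move=> _ /imsetP [x xA ->]; apply: gBA.
Qed.

Lemma leq_card_inj_in (T U : finType) (A : {set T}) (B : {set U}) (f : T -> U) :
  {in A &, injective f} -> {in A, forall x, f x \in B} -> #|A| <= #|B|.
Proof.
move=> f_inj fAB; rewrite -(card_in_imset f_inj); apply/subset_leq_card/subsetP.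
by move=> _ /imsetP [x xA ->]; apply: fAB.
Qed.

Lemma card_partition_by (T U : finType) (P : pred T) (Q : pred U) (h : T -> U) :
  (forall x, P x -> Q (h x)) ->
  #|[set x | P x]| = \sum_(u | Q u) #|[set x | P x && (h x == u)]|.
Proof.
move=> PQ; rewrite -sum1_card (partition_big h Q); last by move=> x; rewrite inE => /PQ.
apply: eq_bigr => u Qu; rewrite -sum1_card; apply: eq_bigl => x.
by rewrite !inE.
Qed.

(** Inversion over the subset lattice: by strong induction on the size of [K], the terms at proper
    subsets of [K] cancel and leave the term at [K]. *)
Lemma subset_sum_inj (T : finType) (a b : {set T} -> nat) :
  (forall K : {set T}, \sum_(M : {set T} | M \subset K) a M =
                       \sum_(M : {set T} | M \subset K) b M) ->
  a =1 b.
Proof.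
move=> eq_ab K; have [k] := ubnP #|K|; elim: k K => // k IHk K leKk.
have := eq_ab K; rewrite (bigD1 K) //= [in RHS](bigD1 K) //=.
rewrite (eq_bigr b) => [/addIn //|M /andP [sMK neMK]].
apply: IHk; apply: (@leq_trans #|K|); last by rewrite -ltnS.
by apply: proper_card; rewrite properEneq neMK.
Qed.

(** * Fillings of a staircase of intervals *)

Section Grid.

Variables m w : nat.
Definition grid := {ffun 'I_m -> {set 'I_w}}.
Implicit Types (l r n : 'I_m -> nat) (C K M : {set 'I_w}) (f g : grid).
Implicit Types (h i j k : 'I_m) (x y z : 'I_w).

(* Rows are numbered from the bottom.  [n] prescribes the row sums; a row with
   [n j = 0] plays no role, so a part of a filling is represented on all the
   rows, with [n] set to 0 outside of that part. *)
Definition fits l r n C f :=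
  [forall j : 'I_m, (f j \subset [set x in C | l j <= x < r j]) && (#|f j| == n j)].

(** No condition on the shape appears: for fillings that fit a staircase, the other two corners come
    for free, as [l i <= l k <= y < x < r i <= r k]. *)
Definition delta_free f :=
  ~~ [exists i : 'I_m, exists k : 'I_m, exists x : 'I_w, exists y : 'I_w,
       [&& i < k, x \in f i, y \in f k & y < x]].

(* As [l] and [r] are weakly increasing, the inequalities below are what remains
   of the requirement that the rows and columns form an occurrence. *)
Definition iota_free l r f :=
  ~~ [exists i : 'I_m, exists k : 'I_m, exists x : 'I_w, exists y : 'I_w,
       [&& i < k, x \in f i, y \in f k, l k <= x, x < y & y < r i]].

(** [x < l k] and [r i <= z] express the two missing corners. The order of the columns then follows,
    since [x < l k <= y < r i <= z] once [y] lies in the range of row [k]. *)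
Definition D_free l r f :=
  ~~ [exists i : 'I_m, exists j : 'I_m, exists k : 'I_m,
       exists x : 'I_w, exists y : 'I_w, exists z : 'I_w,
       [&& i < j, j < k, x \in f i, y \in f k & z \in f j]
       && [&& l j <= x, x < l k, y < r i & r i <= z]].

Definition B_free l r f := iota_free l r f && D_free l r f.

Lemma fitsP l r n C f :
  reflect ((forall j x, x \in f j -> [/\ x \in C, l j <= x & x < r j]) /\
           (forall j, #|f j| = n j))
          (fits l r n C f).
Proof.
apply: (iffP forallP) => [H | [H1 H2] j].
  split=> [j x xj | j]; last by have /andP [_ /eqP] := H j.
  have /andP [/subsetP /(_ x xj)] := H j.
  by rewrite inE => /and3P.
rewrite H2 eqxx andbT; apply/subsetP => x /H1 [xC lx xr].
by rewrite inE xC lx.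
Qed.

Lemma delta_freeP f :
  reflect (forall i k x y, i < k -> x \in f i -> y \in f k -> x <= y)
          (delta_free f).
Proof.
apply: (iffP negP) => [H i k x y ik xi yk | H].
  rewrite leqNgt; apply/negP => yx; apply: H.
  apply/existsP; exists i; apply/existsP; exists k.
  apply/existsP; exists x; apply/existsP; exists y.
  by rewrite ik xi yk.
case/existsP=> i /existsP [k /existsP [x /existsP [y /and4P [ik xi yk]]]].
by rewrite ltnNge (H i k).
Qed.

Lemma iota_freeP l r f :
  reflect (forall i k x y, i < k -> x \in f i -> y \in f k ->
             l k <= x -> x < y -> y < r i -> False)
          (iota_free l r f).
Proof.
apply: (iffP negP) => [H i k x y ik xi yk lx xy yr | H].
  apply: H; apply/existsP; exists i; apply/existsP; exists k.
  apply/existsP; exists x; apply/existsP; exists y.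
  by rewrite ik xi yk lx xy yr.
case/existsP=> i /existsP [k /existsP [x /existsP [y]]].
by case/and5P=> ik xi yk lx /andP [xy yr]; apply: (H i k x y).
Qed.

Lemma D_freeP l r f :
  reflect (forall i j k x y z, i < j -> j < k ->
             x \in f i -> y \in f k -> z \in f j ->
             l j <= x -> x < l k -> y < r i -> r i <= z -> False)
          (D_free l r f).
Proof.
apply: (iffP negP) => [H i j k x y z ij jk xi yk zj lx xl yr rz | H].
  apply: H; apply/existsP; exists i; apply/existsP; exists j.
  apply/existsP; exists k; apply/existsP; exists x; apply/existsP; exists y.
  by apply/existsP; exists z; rewrite ij jk xi yk zj lx xl yr rz.
case/existsP=> i /existsP [j /existsP [k /existsP [x /existsP [y /existsP [z]]]]].
by case/andP=> /and5P [ij jk xi yk zj] /and4P []; apply: (H i j k x y z).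
Qed.

Lemma fits_gt0 l r n C f j x : fits l r n C f -> x \in f j -> 0 < n j.
Proof. by case/fitsP=> _ <- xj; rewrite card_gt0; apply/set0Pn; exists x. Qed.

Definition numA l r n C := #|[set f | fits l r n C f && delta_free f]|.
Definition numB l r n C := #|[set f | fits l r n C f && B_free l r f]|.

(** * Cutting a filling into the rows from [i] upwards and the rows below *)

Section Glue.
Variables (i : 'I_m) (c : 'I_w).

Definition top f : grid := [ffun j : 'I_m => if j < i then set0 else f j].
Definition marks f :=
  [set x : 'I_w | (x < c) && [exists j : 'I_m, (i <= j) && (x \in f j)]].
(** The upper part is compressed into the single row [i], which carries [marks f], the only trace of
    it that matters to the rows below. *)
Definition flat f : grid :=
  [ffun j : 'I_m => if j < i then f j else if j == i then marks f else set0].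

Lemma marksP f x :
  reflect (x < c /\ exists2 j : 'I_m, i <= j & x \in f j) (x \in marks f).
Proof.
rewrite inE; apply: (iffP andP) => [[xc /existsP [j /andP [ij xj]]] | [xc [j ij xj]]].
  by split=> //; exists j.
by split=> //; apply/existsP; exists j; rewrite ij.
Qed.

Lemma marks_top f : marks (top f) = marks f.
Proof.
apply/setP=> x; rewrite !inE; congr (_ && _); apply: eq_existsb => j.
by rewrite ffunE; case: ltnP.
Qed.

(** A filling is determined by [top f] and [flat f], and an upper part [f] can be glued to a
    flattened part [g] exactly when row [i] of [g] is [marks f]. The sum runs over this common value
    [M]. *)
Lemma card_glue (P Q : pred grid) :
  #|[set f | P (top f) && Q (flat f)]| =
  \sum_(M : {set 'I_w}) #|[set f | (P f && (top f == f)) && (marks f == M)]| *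
         #|[set g | (Q g && [forall j : 'I_m, (i < j) ==> (g j == set0)]) && (g i == M)]|.
Proof.
rewrite (card_partition_by (Q := xpredT) (h := marks)) //.
apply: eq_bigr => M _; rewrite -cardsX.
pose glue (p : grid * grid) : grid :=
  [ffun j : 'I_m => if j < i then p.2 j else p.1 j].
have topG p : top p.1 = p.1 -> top (glue p) = p.1.
  move=> tp; rewrite -[RHS]tp; apply/ffunP => j.
  by rewrite !ffunE; case: (j < i).
apply: (card_can_in (f := fun f => (top f, flat f)) (g := glue)).
- move=> f; rewrite !inE => /andP [/andP [Pf Qf] /eqP <-].
  rewrite Pf Qf marks_top eqxx !ffunE ltnn !eqxx !andbT /=.
  apply/andP; split.
    by apply/eqP/ffunP => j; rewrite !ffunE; case: (j < i).
  apply/forallP => j; apply/implyP => ij; rewrite ffunE ltnNge (ltnW ij) /=.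
  by have [e|_] := eqVneq j i; [rewrite e ltnn in ij | rewrite eqxx].
- move=> [f g]; rewrite !inE /= => /andP [/andP [/andP [Pf /eqP tf] /eqP <-]].
  case/andP=> /andP [Qg /forallP g0] /eqP gi.
  have mG : marks (glue (f, g)) = marks f by rewrite -marks_top topG.
  rewrite topG // Pf mG eqxx andbT.
  suff -> : flat (glue (f, g)) = g by [].
  apply/ffunP => j; rewrite !ffunE mG /=; case: ltnP => // ij.
  case: eqP => [-> //|ne]; have /implyP := g0 j; rewrite ltn_neqAle ij andbT.
  by move=> /(_ _) /eqP -> //; apply/eqP => /val_inj e; apply: ne.
- move=> f _; apply/ffunP => j; rewrite !ffunE /=.
  by case: (j < i).
- move=> [f g]; rewrite !inE /= => /andP [/andP [/andP [Pf /eqP tf] /eqP <-]].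
  case/andP=> /andP [Qg /forallP g0] /eqP gi.
  have mG : marks (glue (f, g)) = marks f by rewrite -marks_top topG.
  rewrite topG //; congr (_, _).
  apply/ffunP => j; rewrite !ffunE mG /=; case: ltnP => // ij.
  case: eqP => [-> //|ne]; have /implyP := g0 j; rewrite ltn_neqAle ij andbT.
  by move=> /(_ _) /eqP -> //; apply/eqP => /val_inj e; apply: ne.
Qed.

End Glue.

End Grid.

(** * Removing the last cell of a row *)

Definition staircase m (l r n : 'I_m -> nat) :=
  forall h k : 'I_m, h < k -> 0 < n h -> 0 < n k -> l h <= l k /\ r h <= r k.

Lemma B_free_sub m w (l r : 'I_m -> nat) (f g : grid m w) :
  (forall j x, x \in g j -> x \in f j) -> B_free l r f -> B_free l r g.
Proof.
move=> gf /andP [/iota_freeP If /D_freeP Df]; apply/andP; split.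
  by apply/iota_freeP => i k x y ik /gf xi /gf yk; apply: (If i k).
by apply/D_freeP => i j k x y z ij jk /gf xi /gf yk /gf zj; apply: (Df i j k).
Qed.

Definition rows_from m (i : 'I_m) (n : 'I_m -> nat) : 'I_m -> nat :=
  fun j => if j < i then 0 else n j.

(** Row [i] has one 1-cell fewer because it is to hold the marks: in a [delta_2]-avoider with a 1 in
    column [c] of row [i], these are the other 1-cells of that row. *)
Definition rows_upto m (i : 'I_m) (n : 'I_m -> nat) : 'I_m -> nat :=
  fun j => if j < i then n j else if j == i then (n i).-1 else 0.

Definition shorten_row m (i : 'I_m) (c : nat) (r : 'I_m -> nat) : 'I_m -> nat :=
  fun j => if j == i then c else r j.

Section Corner.

Variables (m w : nat) (l r : 'I_m -> nat) (i : 'I_m) (c : 'I_w).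
Implicit Types (n : 'I_m -> nat) (C K M : {set 'I_w}) (f g : grid m w).
Implicit Types (h j k : 'I_m) (x y z : 'I_w).

Hypothesis r_i : r i = c.+1.

Let r' : 'I_m -> nat := shorten_row i c r.

Let r'_i : r' i = c. Proof. by rewrite /r' /shorten_row eqxx. Qed.
Let r'_ne j : j != i -> r' j = r j. Proof. by rewrite /r' /shorten_row => /negbTE ->. Qed.
Let r'_le j : r' j <= r j.
Proof. by rewrite /r' /shorten_row; case: eqP => // ->; rewrite r_i. Qed.

(* Putting back the cell (c, i) then creates a forbidden pattern: if l k <= z,
   the cells (z, i) and (c, k) form iota_2; otherwise (z, i), (c, k) and (t, j)
   form phi_D, or (z, i) and (t, j) form iota_2 if t = c. *)
Definition straddled f :=
  [exists j : 'I_m, exists k : 'I_m, exists t : 'I_w, exists z : 'I_w,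
    [&& i <= j, j <= k, c \in f k & t \in f j] &&
    [&& c <= t, z \in f i & l j <= z]].

Lemma straddledP f :
  reflect (exists j k t z, [/\ i <= j, j <= k, c \in f k & t \in f j] /\
             [/\ c <= t, z \in f i & l j <= z])
          (straddled f).
Proof.
apply: (iffP existsP) => [[j /existsP [k /existsP [t /existsP [z]]]]|].
  by case/andP=> /and4P H1 /and3P H2; exists j, k, t, z.
case=> j [k [t [z [/and4P H1 /and3P H2]]]]; exists j; apply/existsP; exists k.
by apply/existsP; exists t; apply/existsP; exists z; rewrite H1.
Qed.

(** The two shapes differ only for patterns whose bottom row is [i]. Putting the cell back adds the
    patterns with [y = c], which are excluded by not being straddled. It destroys the occurrences of
    [phi_D] with [z = c], but there the cells in columns [x] of row [i] and [c] of row [j] form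
    [iota_2]. *)
Lemma lower_corner n C f :
  fits l r' n C f && B_free l r' f && ~~ straddled f =
  fits l r n C f && B_free l r f && (c \notin f i).
Proof.
apply/idP/idP.
  case/andP=> /andP [fitf /andP [/iota_freeP If /D_freeP Df]] nS.
  have [mem card] := fitsP _ _ _ _ _ fitf.
  have cNi : c \notin f i.
    by apply/negP => /mem [_ _]; rewrite r'_i ltnn.
  rewrite cNi andbT; apply/andP; split.
    apply/fitsP; split=> // j x /mem [xC lx xr]; split=> //.
    exact: leq_trans xr (r'_le j).
  apply/andP; split.
    apply/iota_freeP => h k x y hk xh yk lx xy yr.
    have [e|ne] := eqVneq h i; last first.
      by apply: (If h k x y) => //; rewrite r'_ne.
    rewrite {h}e r_i ltnS in hk xh yr; have [yc|] := ltnP y c.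
      by apply: (If i k x y) => //; rewrite r'_i.
    move=> cy; have e : y = c by apply/val_inj/eqP; rewrite eqn_leq yr.
    rewrite e in yk xy.
    by case/straddledP: nS; exists k, k, c, x; do !split=> //; apply: ltnW.
  apply/D_freeP => h j k x y z hj jk xh yk zj lx xl yr rz.
  have [e|ne] := eqVneq h i; last first.
    by apply: (Df h j k x y z) => //; rewrite r'_ne.
  rewrite {h}e r_i ltnS in hj xh yr rz; have [yc|] := ltnP y c.
    by apply: (Df i j k x y z) => //; rewrite r'_i // ltnW.
  move=> cy; have e : y = c by apply/val_inj/eqP; rewrite eqn_leq yr.
  rewrite e in yk.
  by case/straddledP: nS; exists j, k, z, x; do !split=> //; apply: ltnW.
case/andP=> /andP [fitf /andP [/iota_freeP If /D_freeP Df]] cNi.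
have [mem card] := fitsP _ _ _ _ _ fitf.
have ltc x : x \in f i -> x < c.
  move=> xi; have [_ _] := mem _ _ xi; rewrite r_i ltnS leq_eqVlt.
  by case/orP=> // /eqP /val_inj e; rewrite e in xi; rewrite xi in cNi.
have Ic j x : i < j -> c \in f j -> x \in f i -> l j <= x -> False.
  by move=> ij cj xi lx; apply: (If i j x c) => //; rewrite ?ltc ?r_i.
apply/andP; split; [apply/andP; split; [| apply/andP; split] |].
- apply/fitsP; split=> // j x xj; have [xC lx xr] := mem _ _ xj; split=> //.
  have [e|ne] := eqVneq j i; last by rewrite r'_ne.
  by rewrite e r'_i; apply: ltc; rewrite -e.
- apply/iota_freeP => h k x y hk xh yk lx xy yr.
  by apply: (If h k x y) => //; apply: leq_trans yr (r'_le h).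
- apply/D_freeP => h j k x y z hj jk xh yk zj lx xl yr rz.
  have [e|ne] := eqVneq h i; last first.
    by rewrite r'_ne // in yr rz; apply: (Df h j k x y z).
  rewrite {h}e r'_i in hj xh yr rz; have [cz|zc] := ltnP c z.
    by apply: (Df i j k x y z) => //; rewrite r_i // ltnS ltnW.
  have e : z = c by apply/val_inj/eqP; rewrite eqn_leq zc.
  by rewrite e in zj; apply: (Ic j x).
- apply/negP => /straddledP [j [k [t [z [[ij jk ck tj] [ct zi lz]]]]]].
  have {}ij : i < j.
    rewrite ltn_neqAle ij andbT; apply/eqP => /val_inj e.
    by rewrite -e in tj; have := ltc _ tj; rewrite ltnNge ct.
  have [lk|lk] := leqP (l k) z; first exact: (Ic k z (leq_trans ij jk)).
  have {}jk : j < k.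
    rewrite ltn_neqAle jk andbT; apply/eqP => /val_inj e.
    by rewrite -e ltnNge lz in lk.
  move: ct; rewrite leq_eqVlt => /orP [/eqP /val_inj e|ct].
    by rewrite -e in tj; apply: (Ic j z).
  by apply: (Df i j k z c t) => //; rewrite r_i.
Qed.

(** * Avoidance tested separately on the upper and the flattened part *)

Section Split.

Variables (n : 'I_m -> nat) (C : {set 'I_w}).
Hypotheses (stair : staircase l r n) (n_i : 0 < n i).
Hypothesis low : forall h, h < i -> 0 < n h -> r h <= c.

Let flat_mem f j x :
  x \in flat i c f j -> (j < i /\ x \in f j) \/ (j = i /\ x \in marks i c f).
Proof.
rewrite ffunE; case: ltnP => ji; first by left.
by case: eqP => [-> xm|]; [right | rewrite inE].
Qed.

Let flat_lt f j x : j < i -> x \in f j -> x \in flat i c f j.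
Proof. by move=> ji; rewrite ffunE ji. Qed.

Let flat_marks f j x : i <= j -> x \in f j -> x < c -> x \in flat i c f i.
Proof.
move=> ij xj xc; rewrite ffunE ltnn eqxx; apply/marksP; split=> //.
by exists j.
Qed.

Let top_mem f j x : x \in top i f j -> x \in f j.
Proof. by rewrite ffunE; case: ifP; rewrite ?inE. Qed.

Let top_ge f j x : i <= j -> x \in f j -> x \in top i f j.
Proof. by rewrite ffunE ltnNge => ->. Qed.

(** If only the upper cell of a pattern lies in a row [k >= i], then [y < x < r h <= c]; so [y] is a
    mark, and row [k] can be exchanged for row [i]. *)
Lemma delta_free_split f : fits l r n C f ->
  delta_free f = delta_free (top i f) && delta_free (flat i c f).
Proof.
move=> fitf; have [mem _] := fitsP _ _ _ _ _ fitf; apply/delta_freeP/andP.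
  move=> H; split; apply/delta_freeP => h k x y hk.
    by move=> /top_mem xh /top_mem yk; apply: (H h k).
  case/flat_mem=> [[hi xh]|[e _]]; case/flat_mem=> [[ki yk]|[e' ym]].
  - exact: (H h k).
  - by case/marksP: ym => _ [k' ik' yk']; apply: (H h k') => //; lia.
  - by rewrite e in hk; lia.
  - by rewrite e e' ltnn in hk.
case=> /delta_freeP Ht /delta_freeP Hf h k x y hk xh yk.
have [ih|hi] := leqP i h.
  by apply: (Ht h k) => //; apply: top_ge => //; apply: leq_trans (ltnW hk).
have [ik|ki] := leqP i k; last by apply: (Hf h k) => //; apply: flat_lt.
have [cy|yc] := leqP c y.
  have [_ _ xr] := mem _ _ xh; have := low hi (fits_gt0 fitf xh); lia.
by apply: (Hf h i) => //; [apply: flat_lt | apply: flat_marks yk yc].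
Qed.

(* The cell t of row j, lying right of all the rows below i, completes an
   occurrence of phi_D whenever a column of [marks] used in row k >= i is not
   compared by iota_2 with row h < i because row k starts too far right. *)
Lemma B_free_split (r0 : 'I_m -> nat) f :
  (forall h, h < i -> r0 h = r h) -> fits l r n C f ->
  (exists j t z, [/\ i <= j, t \in f j, c <= t, z \in f i & l j <= z]) ->
  B_free l r0 f = B_free l r0 (top i f) && B_free l r (flat i c f).
Proof.
move=> r0r fitf [j0 [t [z0 [ij0 tj0 ct z0i lz0]]]].
have [mem _] := fitsP _ _ _ _ _ fitf.
have gt0 j x : x \in f j -> 0 < n j := fits_gt0 fitf.
have lmono j k x y : j <= k -> x \in f j -> y \in f k -> l j <= l k.
  move=> jk xj yk; case: (ltngtP j k) jk => // [jk|/val_inj ->] // _.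
  by have [] := stair jk (gt0 _ _ xj) (gt0 _ _ yk).
apply/idP/andP.
  move=> Bf; split; first by apply: B_free_sub Bf => j x; apply: top_mem.
  have /andP [/iota_freeP If /D_freeP Df] := Bf.
  apply/andP; split.
    apply/iota_freeP => h k x y hk.
    case/flat_mem=> [[hi xh]|[e _]]; last first.
      by rewrite e in hk; case/flat_mem=> [[ki _]|[e' _]]; [lia|rewrite e' ltnn in hk].
    case/flat_mem=> [[ki yk]|[e' /marksP [yc [k' ik' yk']]]] lx xy yr.
      by apply: (If h k x y) => //; rewrite r0r.
    rewrite {k hk}e' in lx.
    have hk' := leq_trans hi ik'.
    have rh := low hi (gt0 _ _ xh).
    (* If row [k'] starts right of [x], a 1-cell of row [i] or [j0] must help. If [x < z0], then
       [z0] gives [iota_2] or, beyond the end of row [h], [phi_D]. If [z0 <= x], then row [j0]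
       reaches left to [x], and [t] completes [phi_D]. *)
    have [lk'|xl] := leqP (l k') x; first by apply: (If h k' x y); rewrite ?r0r.
    have ik'' : i < k'.
      rewrite ltn_neqAle ik' andbT; apply/eqP => /val_inj e.
      by rewrite -e in xl; lia.
    have [xz|zx] := ltnP x z0.
      have [zr|rz] := ltnP z0 (r h); first by apply: (If h i x z0); rewrite ?r0r.
      by apply: (Df h i k' x y z0); rewrite ?r0r.
    have jk' : j0 < k'.
      rewrite ltnNge; apply/negP => kj.
      have := lmono _ _ _ _ kj yk' tj0; lia.
    by apply: (Df h j0 k' x y t); rewrite ?r0r //; lia.
  apply/D_freeP => h j k x y z hj jk.
  case/flat_mem=> [[hi xh]|[e _]]; last first.
    by rewrite e in hj; case/flat_mem=> [[ki _]|[e' _]]; [lia|rewrite e' in jk; lia].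
  case/flat_mem=> [[ki yk]|[e /marksP [yc [k' ik' yk']]]];
    case/flat_mem=> [[ji zj]|[e' _]] lx xl yr rz.
  - by apply: (Df h j k x y z); rewrite ?r0r.
  - by rewrite e' in jk; lia.
  - apply: (Df h j k' x y z); rewrite ?r0r //; first lia.
    have := lmono _ _ _ _ ik' z0i yk'; rewrite e in xl; lia.
  - by rewrite e e' ltnn in jk.
case=> /andP [/iota_freeP It /D_freeP Dt] /andP [/iota_freeP If /D_freeP Df].
apply/andP; split.
  apply/iota_freeP => h k x y hk xh yk lx xy yr.
  have [ih|hi] := leqP i h.
    by apply: (It h k x y) => //; apply: top_ge => //; lia.
  rewrite r0r // in yr; have rh := low hi (gt0 _ _ xh).
  have [ik|ki] := leqP i k; last by apply: (If h k x y) => //; apply: flat_lt.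
  apply: (If h i x y) => //; first exact: flat_lt.
    by apply: (flat_marks ik yk); lia.
  by apply: leq_trans lx; apply: lmono ik z0i yk.
apply/D_freeP => h j k x y z hj jk xh yk zj lx xl yr rz.
have [ih|hi] := leqP i h.
  by apply: (Dt h j k x y z) => //; apply: top_ge => //; lia.
rewrite r0r // in yr rz; have rh := low hi (gt0 _ _ xh).
have [ik|ki] := leqP i k; last first.
  by apply: (Df h j k x y z) => //; apply: flat_lt => //; lia.
have yflat : y \in flat i c f i by apply: (flat_marks ik yk); lia.
have [_ ly _] := mem _ _ yk.
(* With row [k] flattened to row [i], the missing top-left corner may get filled. Then [x] and [y]
   form [iota_2]; otherwise row [j], which contains column [x], starts before row [i] and so lies
   below it. *)
have [li|xi] := leqP (l i) x.
  by apply: (If h i x y) => //; [apply: flat_lt | lia].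
have ji : j < i.
  by rewrite ltnNge; apply/negP => ij; have := lmono _ _ _ _ ij z0i zj; lia.
by apply: (Df h j i x y z) => //; apply: flat_lt.
Qed.

End Split.

(** The sets that can be the marks of a [delta_2]-avoider with a 1 in column [c] of row [i]. *)
Let good n C M := (M \subset [set x in C | l i <= x < c]) && (#|M| == (n i).-1).
Let cut C K : {set 'I_w} := [set x in C | (c <= x) || (x \in K)].

Let fitsL n C f := [forall j : 'I_m, (j < i) ==>
  ((f j \subset [set x in C | l j <= x < r j]) && (#|f j| == n j))].

(** [PB], [QB] and [PA] are the three classes in the identity for upper parts: 1 in the corner,
    straddled, and [delta_2]-avoiding with 1 in the corner. *)
Let PA n C f := (c \in f i) && (fits l r n C f && delta_free f).
Let PB n C f := (c \in f i) && (fits l r n C f && B_free l r f).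
Let QB n C f := straddled f && (fits l r' n C f && B_free l r' f).
Let count (P : pred (grid m w)) M := #|[set f | P f && (marks i c f == M)]|.
Let lower (P : pred (grid m w)) M :=
  #|[set g | (P g && [forall j : 'I_m, (i < j) ==> (g j == set0)]) && (g i == M)]|.

Let top_id (r0 : 'I_m -> nat) n C f : fits l r0 (rows_from i n) C f -> top i f = f.
Proof.
case/fitsP=> _ card; apply/ffunP => j; rewrite ffunE; case: ltnP => // ji.
by have := card j; rewrite /rows_from ji => /eqP; rewrite cards_eq0 => /eqP.
Qed.

Let fits_split (r0 : 'I_m -> nat) n C f :
  (forall h, h < i -> r0 h = r h) ->
  fits l r0 n C f = fits l r0 (rows_from i n) C (top i f) && fitsL n C (flat i c f).
Proof.
move=> r0r; apply/forallP/andP => [H | [/forallP H1 /forallP H2] j].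
  split; apply/forallP => j; rewrite ffunE /rows_from; case: ltnP => // ji.
    by rewrite sub0set cards0 eqxx.
  by rewrite -r0r //= H.
have [ji|ij] := ltnP j i.
  by have := H2 j; rewrite ji /= ffunE ji r0r.
by have := H1 j; rewrite ffunE /rows_from ltnNge ij.
Qed.

Let card_glued n C (P : pred (grid m w)) (P0 Q : pred (grid m w)) (r0 : 'I_m -> nat) :
  (forall f, P f = P0 (top i f) && Q (flat i c f)) ->
  (forall f, P0 f -> fits l r0 (rows_from i n) C f) ->
  #|[set f | P f]| = \sum_(M : {set 'I_w}) count P0 M * lower Q M.
Proof.
move=> PE P0fits.
transitivity #|[set f | P0 (top i f) && Q (flat i c f)]|.
  by apply: eq_card => f; rewrite !inE.
rewrite (card_glue i c P0 Q); apply: eq_bigr => M _; congr (_ * _).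
apply: eq_card => f; rewrite !inE; congr (_ && _).
by apply: andb_idr => /P0fits /top_id ->.
Qed.

Let top_i f : top i f i = f i. Proof. by rewrite ffunE ltnn. Qed.

Let straddled_top f : straddled (top i f) = straddled f.
Proof.
apply/straddledP/straddledP => -[j [k [t [z [[ij jk ck tj] [ct zi lz]]]]]];
  exists j, k, t, z; move: ck tj zi; rewrite !ffunE ltnn.
  by rewrite !ltnNge ij (leq_trans ij jk).
by rewrite !ltnNge ij (leq_trans ij jk).
Qed.

Let card_andC (P R : pred (grid m w)) :
  #|[set f | P f]| = #|[set f | P f && R f]| + #|[set f | P f && ~~ R f]|.
Proof.
rewrite -(cardsID [set f | R f]); congr (_ + _); apply: eq_card => f;
  by rewrite !inE // andbC.
Qed.

(** By [lower_corner], removing [PB] from the avoiders of the shape and [QB] from those of the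
    shortened shape leaves the same fillings. The additive form avoids subtraction of natural
    numbers. *)
Let numB_rec n C :
  numB l r n C + #|[set f | QB n C f]| = numB l r' n C + #|[set f | PB n C f]|.
Proof.
have -> : numB l r n C = #|[set f | PB n C f]| +
    #|[set f | fits l r n C f && B_free l r f && (c \notin f i)]|.
  rewrite /numB (card_andC (fun f => fits l r n C f && B_free l r f)
                           (fun f => c \in f i)).
  by congr (_ + _); apply: eq_card => f; rewrite !inE andbC.
have -> : numB l r' n C = #|[set f | QB n C f]| +
    #|[set f | fits l r n C f && B_free l r f && (c \notin f i)]|.
  rewrite /numB (card_andC (fun f => fits l r' n C f && B_free l r' f) straddled).
  congr (_ + _); apply: eq_card => f; rewrite inE [RHS]inE; first by rewrite andbC.
  exact: lower_corner.
lia.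
Qed.

(** Avoiding [delta_2] does not depend on [r], so the avoiders with a 0 in the corner are exactly
    those of the shortened shape. *)
Let numA_rec n C : numA l r n C = numA l r' n C + #|[set f | PA n C f]|.
Proof.
rewrite /numA (card_andC (fun f => fits l r n C f && delta_free f)
                         (fun f => c \in f i)) addnC; congr (_ + _); last first.
  by apply: eq_card => f; rewrite !inE andbC.
apply: eq_card => f; rewrite !inE andbAC; congr (_ && _).
apply/andP/fitsP => [[/fitsP [mem card] ci]|[mem card]].
  split=> // j x xj; have [xC lx xr] := mem _ _ xj; split=> //.
  have [e|ne] := eqVneq j i; last by rewrite r'_ne.
  rewrite e in xj xr *; rewrite r'_i; move: xr; rewrite r_i ltnS leq_eqVlt.
  by case/orP=> // /eqP /val_inj e'; rewrite -e' xj in ci.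
split; last by apply/negP => /mem [_ _]; rewrite r'_i ltnn.
apply/fitsP; split=> // j x xj; have [xC lx xr] := mem _ _ xj; split=> //.
exact: leq_trans xr (r'_le j).
Qed.

(** Restricting the allowed columns left of [c] to [K] amounts to requiring the marks to lie in [K],
    as the rows below [i] are empty here. *)
Let fits_cut (r0 : 'I_m -> nat) n C K f :
  fits l r0 (rows_from i n) (cut C K) f =
  fits l r0 (rows_from i n) C f && (marks i c f \subset K).
Proof.
apply/fitsP/andP => [[mem card]|[/fitsP [mem card] /subsetP sK]].
  split.
    apply/fitsP; split=> // j x /mem [xC lx xr]; split=> //.
    by move: xC; rewrite inE => /andP [].
  apply/subsetP => x /marksP [xc [j ij /mem [xC _ _]]].
  by move: xC; rewrite inE leqNgt xc => /andP [].
split=> // j x xj; have [xC lx xr] := mem _ _ xj; split=> //.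
rewrite inE xC /=; case: leqP => //= xc; apply: sK; apply/marksP; split=> //.
exists j => //; rewrite leqNgt; apply/negP => ji.
have := card j; rewrite /rows_from ji => /eqP; rewrite cards_eq0 => /eqP e.
by rewrite e inE in xj.
Qed.

Let card_cut (P : {set 'I_w} -> pred (grid m w)) C K :
  (forall f, P (cut C K) f = P C f && (marks i c f \subset K)) ->
  #|[set f | P (cut C K) f]| = \sum_(M : {set 'I_w} | M \subset K) count (P C) M.
Proof.
move=> PE; rewrite (@card_partition_by _ _ _ (fun M : {set 'I_w} => M \subset K)
                            (marks i c)).
  apply: eq_bigr => M sMK; apply: eq_card => f; rewrite !inE PE.
  by case: eqP => [->|]; rewrite ?andbF // sMK andbT.
by move=> f; rewrite PE => /andP [].
Qed.

(** * Products of upper and lower counts *)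

Section Counts.

Variables (n : 'I_m -> nat) (C : {set 'I_w}).
Hypotheses (stair : staircase l r n) (n_i : 0 < n i).
Hypothesis low : forall h, h < i -> 0 < n h -> r h <= c.

Let PA_split f : PA n C f =
  PA (rows_from i n) C (top i f) &&
  (fitsL n C (flat i c f) && delta_free (flat i c f)).
Proof.
rewrite /PA top_i; case: (c \in f i) => //=.
case: (boolP (fits l r n C f)) => fitf; last first.
  move: fitf; rewrite (@fits_split r) //; case: (fits l r _ C _) => //= /negbTE ->.
  by rewrite andbF.
rewrite (delta_free_split n_i low fitf); move: fitf; rewrite (@fits_split r) //.
by case/andP=> -> ->.
Qed.

Let PB_split f : PB n C f =
  PB (rows_from i n) C (top i f) &&
  (fitsL n C (flat i c f) && B_free l r (flat i c f)).
Proof.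
rewrite /PB top_i; case: (boolP (c \in f i)) => //= ci.
case: (boolP (fits l r n C f)) => fitf; last first.
  move: fitf; rewrite (@fits_split r) //; case: (fits l r _ C _) => //= /negbTE ->.
  by rewrite andbF.
rewrite (B_free_split stair n_i low (r0 := r) _ fitf) //; last first.
  exists i, c, c; split=> //.
  by have /fitsP [mem _] := fitf; have [] := mem _ _ ci.
by move: fitf; rewrite (@fits_split r) // => /andP [-> ->].
Qed.

(** The lower factor uses [r], not [r'], and is thus the one of [PB_split]: row [i] is the highest
    row that [flat] can fill, and only the right end of the lowest row of a pattern is ever
    tested. *)
Let QB_split f : QB n C f =
  QB (rows_from i n) C (top i f) &&
  (fitsL n C (flat i c f) && B_free l r (flat i c f)).
Proof.
have r'r h : h < i -> r' h = r h.
  by move=> hi; apply: r'_ne; apply/eqP => e; rewrite e ltnn in hi.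
rewrite /QB straddled_top; case: (boolP (straddled f)) => //= Sf.
case: (boolP (fits l r' n C f)) => fitf; last first.
  move: fitf; rewrite (fits_split _ _ _ r'r); case: (fits l r' _ C _) => //= /negbTE ->.
  by rewrite andbF.
rewrite (B_free_split stair n_i low (r0 := r') r'r (C := C)); last 2 first.
- apply/fitsP; have [mem card] := fitsP _ _ _ _ _ fitf; split=> // j x xj.
  by have [xC lx xr] := mem _ _ xj; split=> //; apply: leq_trans xr (r'_le j).
- by have /straddledP [j [k [t [z [[ij jk ck tj] [ct zi lz]]]]]] := Sf; exists j, t, z.
by move: fitf; rewrite (fits_split _ _ _ r'r) => /andP [-> ->].
Qed.

Let FA := fun g => fitsL n C g && delta_free g.
Let FB := fun g => fitsL n C g && B_free l r g.

Let numB_split : #|[set f | PB n C f]| =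
  \sum_(M : {set 'I_w}) count (PB (rows_from i n) C) M * lower FB M.
Proof. by apply: (card_glued (n := n) (C := C) PB_split (r0 := r)) => f /and3P []. Qed.

Let numA_split : #|[set f | PA n C f]| =
  \sum_(M : {set 'I_w}) count (PA (rows_from i n) C) M * lower FA M.
Proof. by apply: (card_glued (n := n) (C := C) PA_split (r0 := r)) => f /and3P []. Qed.

Let numQ_split : #|[set f | QB n C f]| =
  \sum_(M : {set 'I_w}) count (QB (rows_from i n) C) M * lower FB M.
Proof. by apply: (card_glued (n := n) (C := C) QB_split (r0 := r')) => f /and3P []. Qed.

(** With a 1 in column [c] of row [i], avoiding [delta_2] forces all 1-cells above row [i] to
    columns from [c] on, so the marks are row [i] without [c]. *)
Let count_PA_good M : count (PA (rows_from i n) C) M != 0 -> good n C M.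
Proof.
rewrite -lt0n card_gt0 => /set0Pn [f]; rewrite inE.
case/andP=> /and3P [ci fitf Af] /eqP <-.
have [mem card] := fitsP _ _ _ _ _ fitf.
suff -> : marks i c f = f i :\ c.
  rewrite /good; have -> : n i = #|f i| by rewrite card /rows_from ltnn.
  apply/andP; split; last by rewrite (cardsD1 c (f i)) ci eqxx.
  apply/subsetP => x; rewrite !inE => /andP [xc /mem [-> -> ]].
  by rewrite r_i ltnS leq_eqVlt => /orP [/eqP /val_inj|//] => e; rewrite e eqxx in xc.
apply/setP => x; rewrite in_setD1; apply/marksP/andP => [[xc [j ij xj]]|[xc xi]].
  split; first by apply: contraTneq xc => ->; rewrite ltnn.
  move: ij; rewrite leq_eqVlt => /orP [/eqP /val_inj -> //|ij].
  by have := delta_freeP _ Af i j c x ij ci xj; rewrite leqNgt xc.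
split; last by exists i.
have [_ _] := mem _ _ xi; rewrite r_i ltnS leq_eqVlt => /orP [/eqP /val_inj|//] => e.
by rewrite e eqxx in xc.
Qed.

(** Row [i] is [c |: M1], and all 1-cells above it lie at or beyond [c]; replacing the row by
    [c |: M2] therefore creates no [delta_2]. By symmetry the count is the same for all good
    sets. *)
Let leq_count_PA M1 M2 : good n C M1 -> good n C M2 ->
  count (PA (rows_from i n) C) M1 <= count (PA (rows_from i n) C) M2.
Proof.
move=> /andP [/subsetP sM1 /eqP cM1] /andP [/subsetP sM2 /eqP cM2].
pose swap (f : grid m w) : grid m w := [ffun j => if j == i then c |: M2 else f j].
have row_i f M : PA (rows_from i n) C f -> marks i c f = M -> f i = c |: M.
  case/and3P=> ci fitf Af <-; have [mem card] := fitsP _ _ _ _ _ fitf.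
  apply/setP => x; rewrite in_setU1; apply/idP/orP.
    move=> xi; have [_ _] := mem _ _ xi; rewrite r_i ltnS leq_eqVlt.
    case/orP=> [/eqP /val_inj ->|xc]; first by left; rewrite eqxx.
    by right; apply/marksP; split=> //; exists i.
  case=> [/eqP -> //|/marksP [xc [j ij xj]]].
  move: ij; rewrite leq_eqVlt => /orP [/eqP /val_inj -> //|ij].
  by have := delta_freeP _ Af i j c x ij ci xj; rewrite leqNgt xc.
have above f j x : PA (rows_from i n) C f -> i < j -> x \in f j -> c <= x.
  by case/and3P=> ci fitf Af ij xj; apply: (delta_freeP _ Af i j).
apply: (leq_card_inj_in (f := swap)).
  move=> f g; rewrite !inE => /andP [Pf /eqP mf] /andP [Pg /eqP mg] /ffunP e.
  apply/ffunP => j; have := e j; rewrite !ffunE.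
  by case: eqP => // ->; rewrite (row_i f M1) // (row_i g M1).
move=> f; rewrite !inE => /andP [Pf /eqP mf].
have /and3P [ci fitf Af] := Pf; have [mem card] := fitsP _ _ _ _ _ fitf.
have cM2' : c \notin M2 by apply/negP => /sM2; rewrite inE ltnn !andbF.
have cM1' : c \notin M1 by apply/negP => /sM1; rewrite inE ltnn !andbF.
have low0 j : j < i -> f j = set0.
  by move=> ji; apply/eqP; rewrite -cards_eq0 card /rows_from ji.
have ge_i j x : x \in f j -> i <= j.
  by move=> xj; rewrite leqNgt; apply/negP => /low0 e; rewrite e inE in xj.
apply/andP; split; [apply/and3P; split|].
- by rewrite ffunE eqxx in_setU1 eqxx.
- apply/fitsP; split=> j; rewrite ffunE.
    move=> x; case: eqP => [->|_]; last exact: mem.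
    rewrite in_setU1 => /orP [/eqP ->|/sM2]; first by have [] := mem _ _ ci.
    by rewrite inE => /and3P [-> -> xc]; rewrite r_i ltnS ltnW.
  case: eqP => [->|_]; last exact: card.
  rewrite -card (row_i f M1) // !cardsU1 cM2' cM1' /=; congr (_ + _).
  by rewrite cM2 cM1.
- apply/delta_freeP => h k x y hk; rewrite !ffunE.
  case: eqP hk => [-> ik|ne hk xh].
    rewrite -[k == i]val_eqE /= gtn_eqF //= in_setU1 => xi.
    move=> /(above _ _ _ Pf ik); apply: leq_trans.
    by case/orP: xi => [/eqP -> //|/sM2]; rewrite inE => /and3P [_ _ /ltnW].
  have ih := ge_i _ _ xh.
  case: eqP hk => [-> hi|_ hk]; last exact: (delta_freeP _ Af h k).
  by rewrite ltnNge ih in hi.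
- apply/eqP/setP => x; apply/marksP/idP => [[xc [j ij]]|xM].
    rewrite ffunE; case: eqP => [_|ne xj].
      by rewrite in_setU1 => /orP [/eqP e|//]; rewrite e ltnn in xc.
    have {}ij : i < j by rewrite ltn_neqAle ij andbT; apply/eqP => /val_inj e; case: ne.
    by have := above _ _ _ Pf ij xj; rewrite leqNgt xc.
  split; first by have := sM2 _ xM; rewrite inE => /and3P [].
  by exists i => //; rewrite ffunE eqxx in_setU1 xM orbT.
Qed.

(** Summed over the good marks, the lower parts are again the fillings of a staircase, with row [i]
    on top. The restriction to columns left of [c] affects only row [i], since the rows below end by
    [c]. *)
Let card_good_lower (free : pred (grid m w)) :
  #|[set g | fits l r (rows_upto i n) [set x in C | x < c] g && free g]| =
  \sum_(M : {set 'I_w} | good n C M) lower (fun g => fitsL n C g && free g) M.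
Proof.
have fitsE g : fits l r (rows_upto i n) [set x in C | x < c] g =
    (fitsL n C g && [forall j : 'I_m, (i < j) ==> (g j == set0)]) && good n C (g i).
  apply/fitsP/andP => [[mem card]|[/andP [/forallP gL /forallP g0]]
                                  /andP [/subsetP si /eqP ci]].
    split; [apply/andP; split|].
    - apply/forallP => j; apply/implyP => ji; rewrite card /rows_upto ji eqxx andbT.
      apply/subsetP => x /mem [xC lx xr].
      by move: xC; rewrite !inE => /andP [-> _]; rewrite lx.
    - apply/forallP => j; apply/implyP => ij; rewrite -cards_eq0 card /rows_upto.
      rewrite ltnNge (ltnW ij) /=; suff /negbTE -> : j != i by [].
      by apply: contraTneq ij => ->; rewrite ltnn.
    - rewrite /good card /rows_upto ltnn !eqxx andbT; apply/subsetP => x /mem [xC lx xr].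
      by move: xC; rewrite !inE => /andP [-> ->]; rewrite lx.
  split=> j; rewrite /rows_upto; last first.
    case: ltnP => ji; first by have := gL j; rewrite ji => /andP [_ /eqP].
    case: eqP => [->|ne] //.
    have {}ij : i < j by rewrite ltn_neqAle ji andbT; apply/eqP => /val_inj e; case: ne.
    by have := g0 j; rewrite ij => /eqP ->; rewrite cards0.
  move=> x; case: (ltngtP j i) => [ji|ij|/val_inj ->] xj.
  - have := gL j; rewrite ji => /andP [/subsetP /(_ x xj)].
    rewrite !inE => /and3P [-> -> xr] /eqP cj; split=> //.
    apply: leq_trans xr (low ji _); rewrite -cj card_gt0; apply/set0Pn; by exists x.
  - by have := g0 j; rewrite ij => /eqP e; rewrite e inE in xj.
  - have := si _ xj; rewrite !inE => /and3P [-> -> xc]; split=> //.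
    by rewrite r_i ltnS ltnW.
rewrite (@card_partition_by _ _ _ (good n C) (fun g : grid m w => g i)).
  apply: eq_bigr => M gM; apply: eq_card => g; rewrite !inE fitsE.
  case: eqP => [->|]; rewrite ?andbF // gM !andbT.
  by rewrite andbAC.
by move=> g; rewrite fitsE => /andP [/andP [_ ->]].
Qed.

(** The hypotheses concern, in order, the upper part in the given and in the shortened shape, the
    lower part with row [i] on top, and the whole filling in the shortened shape. *)
Lemma num_corner :
  (forall K, numA l r (rows_from i n) K = numB l r (rows_from i n) K) ->
  (forall K, numA l (shorten_row i c r) (rows_from i n) K =
             numB l (shorten_row i c r) (rows_from i n) K) ->
  numA l r (rows_upto i n) [set x in C | x < c] =
    numB l r (rows_upto i n) [set x in C | x < c] ->
  numA l (shorten_row i c r) n C = numB l (shorten_row i c r) n C ->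
  numA l r n C = numB l r n C.
Proof.
rewrite -[shorten_row i c r]/r' => IHT IHT' IH2 IHS.
have countE : count (PB (rows_from i n) C) =1
    (fun M => count (QB (rows_from i n) C) M + count (PA (rows_from i n) C) M).
  (* Summed over [M] inside [K], the three counts are those for the allowed columns [cut C K], where
     the identity follows from the two recursions and the hypotheses on the upper part. *)
  apply: subset_sum_inj => K; rewrite big_split /=.
  have cPB : #|[set f | PB (rows_from i n) (cut C K) f]| =
      \sum_(M : {set 'I_w} | M \subset K) count (PB (rows_from i n) C) M.
    apply: (card_cut (P := PB (rows_from i n))) => f; rewrite /PB fits_cut.
    case: (c \in f i) => //; case: (fits _ _ _ _ f) => //=.
    by rewrite andbC.
  have cQB : #|[set f | QB (rows_from i n) (cut C K) f]| =
      \sum_(M : {set 'I_w} | M \subset K) count (QB (rows_from i n) C) M.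
    apply: (card_cut (P := QB (rows_from i n))) => f; rewrite /QB fits_cut.
    case: (straddled f) => //; case: (fits _ _ _ _ f) => //=.
    by rewrite andbC.
  have cPA : #|[set f | PA (rows_from i n) (cut C K) f]| =
      \sum_(M : {set 'I_w} | M \subset K) count (PA (rows_from i n) C) M.
    apply: (card_cut (P := PA (rows_from i n))) => f; rewrite /PA fits_cut.
    case: (c \in f i) => //; case: (fits _ _ _ _ f) => //=.
    by rewrite andbC.
  apply: etrans (esym cPB) _; apply: etrans (congr2 addn cQB cPA).
  have combine a a' b b' p q t : b + q = b' + p -> a = a' + t ->
    a = b -> a' = b' -> p = q + t by lia.
  exact: combine (numB_rec _ _) (numA_rec _ _) (IHT _) (IHT' _).
(* The lower counts need not agree for each [M]. But the [PA] count vanishes off the good sets and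
   is constant on them, so only the sum of the lower counts over good sets matters. *)
have lowerE : \sum_(M : {set 'I_w}) count (PA (rows_from i n) C) M * lower FA M =
    \sum_(M : {set 'I_w}) count (PA (rows_from i n) C) M * lower FB M.
  have restrict F : \sum_(M : {set 'I_w}) count (PA (rows_from i n) C) M * F M =
      \sum_(M : {set 'I_w} | good n C M) count (PA (rows_from i n) C) M * F M.
    rewrite [LHS](bigID (good n C)) /= [X in _ + X]big1 ?addn0 // => M nM.
    by case: eqP (@count_PA_good M) nM => [-> //|_ /(_ isT) ->].
  rewrite !restrict.
  case: (pickP (good n C)) => [M0 gM0|none]; last by rewrite !big_pred0.
  have const F : \sum_(M : {set 'I_w} | good n C M)
        count (PA (rows_from i n) C) M * F M =
      count (PA (rows_from i n) C) M0 * \sum_(M : {set 'I_w} | good n C M) F M.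
    rewrite big_distrr /=; apply: eq_bigr => M gM; congr (_ * _).
    by apply/eqP; rewrite eqn_leq !leq_count_PA.
  rewrite !const; congr (_ * _); move: IH2; rewrite /numA /numB.
  by rewrite (card_good_lower (@delta_free m w)) (card_good_lower (B_free l r)).
have sumE : \sum_(M : {set 'I_w}) count (PB (rows_from i n) C) M * lower FB M =
    \sum_(M : {set 'I_w}) count (QB (rows_from i n) C) M * lower FB M +
    \sum_(M : {set 'I_w}) count (PA (rows_from i n) C) M * lower FB M.
  rewrite -big_split; apply: eq_bigr => M _; apply: etrans (mulnDl _ _ _).
  exact: (f_equal (muln^~ (lower FB M)) (countE M)).
have combine a a' b b' p q t : b + q = b' + p -> a = a' + t ->
  a' = b' -> p = q + t -> a = b by lia.
apply: combine (numB_rec n C) (numA_rec n C) IHS _.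
apply: etrans numB_split (etrans sumE _).
exact: (f_equal2 addn (esym numQ_split)
                      (etrans (esym lowerE) (esym numA_split))).
Qed.

End Counts.

End Corner.

(** * Rows with a common right end *)

Lemma sorted_enum_ord w (E : {set 'I_w}) : sorted (fun x y : 'I_w => x < y) (enum E).
Proof.
rewrite /enum_mem; apply: sorted_filter; first by move=> x y z; apply: ltn_trans.
rewrite -enumT -(sorted_map (f := val) (e' := ltn)) val_enum_ord.
exact: iota_ltn_sorted.
Qed.

(** The map sends the element of a given rank in [E] to the element of the same rank in [E']. *)
Lemma increasing_map w (E E' : {set 'I_w}) : #|E| <= #|E'| ->
  exists g : 'I_w -> 'I_w, (forall x, x \in E -> g x \in E') /\
    (forall x y, x \in E -> y \in E -> x < y -> g x < g y).
Proof.
move=> leE; pose g x := nth x (enum E') (index x (enum E)).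
have tr : transitive (fun x y : 'I_w => x < y) by move=> x y z; apply: ltn_trans.
have idx x : x \in E -> index x (enum E) < size (enum E').
  by move=> xE; rewrite -cardE (leq_trans _ leE) // cardE index_mem mem_enum.
exists g; split=> [x xE|x y xE yE xy].
  by rewrite -mem_enum; apply: mem_nth; apply: idx.
have lt_idx : index x (enum E) < index y (enum E).
  rewrite ltnNge leq_eqVlt; apply/negP => /orP [/eqP e|lt_yx].
    have ny : nth x (enum E) (index y (enum E)) = y by rewrite nth_index ?mem_enum.
    have e' : y = x by rewrite -ny e nth_index ?mem_enum.
    by rewrite e' ltnn in xy.
  have := sorted_ltn_index tr (sorted_enum_ord E) y x.
  by rewrite !mem_enum lt_yx ltnNge (ltnW xy) => /(_ yE xE isT).
rewrite /g (set_nth_default x (s := enum E') y) ?idx //.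
by apply: (sorted_ltn_nth tr x (sorted_enum_ord E')) => //; rewrite inE idx.
Qed.

(** Compose the increasing map from [E] to its mirror image under [rev_ord] with [rev_ord]
    itself. *)
Lemma reversing_map w (E : {set 'I_w}) :
  exists g : 'I_w -> 'I_w, (forall x, x \in E -> g x \in E) /\
    (forall x y, x \in E -> y \in E -> x < y -> g y < g x).
Proof.
have cardE : #|E| <= #|[set rev_ord x | x in E]| by rewrite card_imset //; apply: rev_ord_inj.
have [g [gE g_lt]] := increasing_map cardE.
exists (fun x => rev_ord (g x)); split=> [x /gE /imsetP [y yE ->]|x y xE yE xy].
  by rewrite rev_ordK.
by have := g_lt x y xE yE xy; rewrite /=; have := ltn_ord (g y); lia.
Qed.

Section EqualEnds.

Variables (m w : nat) (l r : 'I_m -> nat).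
Implicit Types (n : 'I_m -> nat) (C E X : {set 'I_w}) (f : grid m w).
Implicit Types (h i j k : 'I_m) (x y z : 'I_w).

(** Avoiding [delta_2] only compares columns, so relabelling the columns by an increasing map that
    respects the row ranges is an injection between avoiders. *)
Lemma leq_numA_relabel n C C' (g : 'I_w -> 'I_w) :
  (forall x, x \in C -> g x \in C') ->
  (forall x y, x \in C -> y \in C -> x < y -> g x < g y) ->
  (forall j x, 0 < n j -> x \in C -> l j <= x < r j -> l j <= g x < r j) ->
  numA l r n C <= numA l r n C'.
Proof.
move=> gC g_lt g_row.
have g_inj : {in C &, injective g}.
  move=> x y xC yC e; case: (ltngtP x y) => [/g_lt|/g_lt|/val_inj //].
    by rewrite e ltnn => /(_ xC yC).
  by rewrite e ltnn => /(_ yC xC).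
have g_le x y : x \in C -> y \in C -> x <= y -> g x <= g y.
  by move=> xC yC; rewrite leq_eqVlt => /orP [/eqP/val_inj ->//|/g_lt lt]; apply/ltnW/lt.
apply: (leq_card_inj_in (f := fun f : grid m w => [ffun j => g @: f j])).
  move=> f f'; rewrite !inE => /andP [/fitsP [mem _] _] /andP [/fitsP [mem' _] _] /ffunP e.
  apply/ffunP => j; have := e j; rewrite !ffunE => {}e.
  apply/setP => x; apply/idP/idP => xj; have := imset_f g xj.
    rewrite e => /imsetP [y yj /g_inj ->] //.
      by have [] := mem _ _ xj.
    by have [] := mem' _ _ yj.
  rewrite -e => /imsetP [y yj /g_inj ->] //.
    by have [] := mem' _ _ xj.
  by have [] := mem _ _ yj.
move=> f; rewrite !inE => /andP [fitf /delta_freeP Af].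
have [mem card] := fitsP _ _ _ _ _ fitf; apply/andP; split.
  apply/fitsP; split=> j; rewrite ffunE.
    move=> _ /imsetP [x xj ->]; have [xC lx xr] := mem _ _ xj.
    have := g_row _ _ (fits_gt0 fitf xj) xC; rewrite lx xr => /(_ isT) /andP [-> ->].
    by split=> //; apply: gC.
  rewrite -card; apply: card_in_imset => x y /mem [xC _ _] /mem [yC _ _].
  exact: g_inj.
apply/delta_freeP => i k x y ik; rewrite !ffunE.
move=> /imsetP [x' xi ->] /imsetP [y' yk ->].
have [xC _ _] := mem _ _ xi; have [yC _ _] := mem _ _ yk.
by apply: g_le => //; apply: (Af i k).
Qed.

(** Every nonempty row contains the whole stretch from [L] to [R], so within it only the number of
    allowed columns matters. *)
Lemma leq_numA_above n C C' (L R : nat) :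
  (forall j, 0 < n j -> l j <= L /\ r j = R) ->
  (forall x : 'I_w, ~~ (L <= x < R) -> (x \in C) = (x \in C')) ->
  #|[set x in C | L <= x < R]| <= #|[set x in C' | L <= x < R]| ->
  numA l r n C <= numA l r n C'.
Proof.
move=> rows eqC /increasing_map [g [gC g_lt]].
have gE x : x \in C -> L <= x < R -> g x \in C' /\ L <= g x < R.
  by move=> xC xLR; have := gC x; rewrite !inE xC xLR => /(_ isT) /andP.
apply: (@leq_numA_relabel n C C' (fun x => if L <= x < R then g x else x)).
- move=> x xC; case: ifP => xLR; first by have [] := gE x xC xLR.
  by rewrite -eqC ?xLR.
- move=> x y xC yC xy; case: ifP => xLR; case: ifP => yLR //.
  + by apply: g_lt; rewrite ?inE ?xC ?yC.
  + by have [_] := gE x xC xLR; move: xLR yLR; lia.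
  + by have [_] := gE y yC yLR; move: xLR yLR; lia.
- move=> j x n_j xC xrow; have [lL rR] := rows j n_j; case: ifP => // xLR.
  by have [_] := gE x xC xLR; rewrite rR; move: lL; lia.
Qed.

Variables (n : 'I_m -> nat) (C : {set 'I_w}) (k : 'I_m).
Hypothesis above_k : forall j, k < j -> n j = 0.
Hypothesis n_k : 0 < n k.
Hypothesis stair : staircase l r n.
Hypothesis ends : forall j, 0 < n j -> r j = r k.

Definition drop_row (k : 'I_m) (n : 'I_m -> nat) : 'I_m -> nat :=
  fun j => if j == k then 0 else n j.

Let E : {set 'I_w} := [set x in C | l k <= x < r k].
Let row_ok X := (X \subset E) && (#|X| == n k).
Let clear f : grid m w := [ffun j => if j == k then set0 else f j].

(** When the top row, with 1-cells [X], acts on the other rows only by restricting their columns to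
    [D X], it can be emptied and the restriction kept. *)
Let card_top_row (free : pred (grid m w)) (D : {set 'I_w} -> {set 'I_w}) :
  (forall X, D X \subset C) ->
  (forall f, fits l r n C f ->
    free f = free (clear f) && [forall j : 'I_m, (j != k) ==> (f j \subset D (f k))]) ->
  #|[set f | fits l r n C f && free f]| =
  \sum_(X | row_ok X) #|[set f | fits l r (drop_row k n) (D X) f && free f]|.
Proof.
move=> sDC freeE.
rewrite (@card_partition_by _ _ _ row_ok (fun f : grid m w => f k)); last first.
  move=> f /andP [/fitsP [mem card] _]; rewrite /row_ok card eqxx andbT.
  by apply/subsetP => x /mem [xC lx xr]; rewrite inE xC lx.
apply: eq_bigr => X /andP [/subsetP sXE /eqP cX].
pose put f : grid m w := [ffun j => if j == k then X else f j].
have clear_put f : f k = set0 -> clear (put f) = f.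
  by move=> fk; apply/ffunP => j; rewrite !ffunE; case: eqP => // ->.
have row0 f : fits l r (drop_row k n) (D X) f -> f k = set0.
  by case/fitsP=> _ card; apply/eqP; rewrite -cards_eq0 card /drop_row eqxx.
apply: (card_can_in (f := clear) (g := put)).
- move=> f; rewrite !inE => /andP [/andP [fitf]]; rewrite freeE //.
  case/andP=> -> /forallP sD /eqP fk; rewrite andbT.
  have [mem card] := fitsP _ _ _ _ _ fitf; apply/fitsP; split=> j; rewrite ffunE.
    move=> x; case: ifP => jk; first by rewrite inE.
    move=> xj; have [_ lx xr] := mem _ _ xj; split=> //.
    by have := sD j; rewrite jk fk => /subsetP; apply.
  by rewrite /drop_row; case: ifP => _; rewrite ?cards0.
- move=> f; rewrite !inE => /andP [fitf free_f]; have fk := row0 _ fitf.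
  have [mem card] := fitsP _ _ _ _ _ fitf.
  have fit' : fits l r n C (put f).
    apply/fitsP; split=> j; rewrite ffunE.
      move=> x; case: eqP => [->|jk].
        by move=> /sXE; rewrite inE => /and3P.
      move=> xj; have [xD lx xr] := mem _ _ xj; split=> //.
      exact: (subsetP (sDC X)).
    by case: eqP => [->//|/eqP/negbTE jk]; rewrite card /drop_row jk.
  rewrite fit' freeE // clear_put // free_f ffunE eqxx eqxx !andbT /=.
  apply/forallP => j; apply/implyP => /negbTE jk; rewrite ffunE jk.
  by apply/subsetP => x /mem [].
- move=> f; rewrite !inE => /andP [_ /eqP fk]; apply/ffunP => j; rewrite !ffunE.
  by case: eqP => // ->.
- move=> f; rewrite !inE => /andP [/row0 fk _]; exact: clear_put.
Qed.

(** Columns outside [E] stay unrestricted: the rows end together, so such a column used by a lower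
    row is left of row [k] and forms no pattern with it. *)
Let below X : {set 'I_w} := [set x in C | (x \in E) ==> [forall y in X, x <= y]].
Let beyond X : {set 'I_w} := [set x in C | (x \in E) ==> [forall y in X, y <= x]].

Let memE f x : fits l r n C f -> x \in f k -> x \in E.
Proof. by case/fitsP=> mem _ /mem [xC lx xr]; rewrite inE xC lx. Qed.

Let lt_k f j x : fits l r n C f -> x \in f j -> j != k -> j < k.
Proof.
move=> fitf xj jk; rewrite ltn_neqAle; apply/andP; split=> //.
by rewrite leqNgt; apply/negP => /above_k e; have := fits_gt0 fitf xj; rewrite e.
Qed.

Let clear_sub f j x : x \in clear f j -> x \in f j.
Proof. by rewrite ffunE; case: eqP; rewrite ?inE. Qed.

Let clear_ne f j x : j != k -> x \in f j -> x \in clear f j.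
Proof. by rewrite ffunE => /negbTE ->. Qed.

Let numA_top_row :
  numA l r n C = \sum_(X | row_ok X) numA l r (drop_row k n) (below X).
Proof.
apply: card_top_row => [X|f fitf]; first by apply/subsetP => x; rewrite inE => /andP [].
have [mem _] := fitsP _ _ _ _ _ fitf.
apply/delta_freeP/andP => [H|[/delta_freeP H /forallP sD] i j x y ij xi yj].
  split; first by apply/delta_freeP => i j x y ij /clear_sub xi /clear_sub; apply: (H i j).
  apply/forallP => j; apply/implyP => jk; apply/subsetP => x xj.
  have [xC _ _] := mem _ _ xj; rewrite inE xC /=; apply/implyP => _.
  apply/forallP => y; apply/implyP => yk; apply: (H j k) => //.
  exact: lt_k xj jk.
have ik : i != k by apply: contraTneq ij => ->; rewrite -leqNgt leqNgt;
  apply/negP => /above_k e; have := fits_gt0 fitf yj; rewrite e.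
have [e|jk] := eqVneq j k; last by apply: (H i j) => //; apply: clear_ne.
rewrite e in yj; have := sD i; rewrite ik => /subsetP /(_ x xi).
rewrite inE => /andP [xC /implyP xE].
have [xE'|xNE] := boolP (x \in E).
  by have /forallP /(_ y) := xE xE'; rewrite yj.
have [_ ly _] := mem _ _ yj; have [_ _ xr] := mem _ _ xi.
move: xNE; rewrite inE xC /= -(ends (fits_gt0 fitf xi)) xr andbT -ltnNge => xl.
by apply: ltnW; apply: leq_trans xl ly.
Qed.

(** With a common right end [phi_D] cannot occur, because [z] would have to lie beyond the end of
    row [i] but inside row [j]. Only [iota_2] is left. *)
Let numB_top_row :
  numB l r n C = \sum_(X | row_ok X) numB l r (drop_row k n) (beyond X).
Proof.
apply: card_top_row => [X|f fitf]; first by apply/subsetP => x; rewrite inE => /andP [].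
have [mem _] := fitsP _ _ _ _ _ fitf.
have rE j x : x \in f j -> r j = r k by move=> xj; apply: ends (fits_gt0 fitf xj).
apply/andP/andP => [[/iota_freeP H /D_freeP HD]|[/andP [/iota_freeP H _] /forallP sD]].
  split; [apply/andP; split|].
  - by apply/iota_freeP => i j x y ij /clear_sub xi /clear_sub; apply: (H i j).
  - apply/D_freeP => i j h x y z ij jh /clear_sub xi /clear_sub yh /clear_sub.
    exact: (HD i j h).
  - apply/forallP => j; apply/implyP => jk; apply/subsetP => x xj.
    have [xC lx xr] := mem _ _ xj; rewrite inE xC /=; apply/implyP.
    rewrite inE => /and3P [_ lkx xrk]; apply/forallP => y; apply/implyP => yk.
    rewrite leqNgt; apply/negP => xy; apply: (H j k x y) => //.
      exact: lt_k xj jk.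
    by have [_ _] := mem _ _ yk; rewrite (rE j x xj).
split; last first.
  apply/D_freeP => i j h x y z ij jh xi yh zj lx xl yr.
  by have [_ _] := mem _ _ zj; rewrite (rE j z zj) (rE i x xi) ltnNge => /negP.
apply/iota_freeP => i j x y ij xi yj lx xy yr.
have ik : i != k by apply: contraTneq ij => ->; rewrite -leqNgt leqNgt;
  apply/negP => /above_k e; have := fits_gt0 fitf yj; rewrite e.
have [e|jk] := eqVneq j k.
  rewrite e in yj lx; have := sD i; rewrite ik => /subsetP /(_ x xi).
  have [xC _ xr] := mem _ _ xi; rewrite (rE i x xi) in xr.
  rewrite inE xC inE xC lx xr /= => /forallP /(_ y); rewrite yj /= => yx.
  by rewrite ltnNge yx in xy.
by apply: (H i j x y) => //; apply: clear_ne.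
Qed.

Lemma num_top_row :
  (forall C', numA l r (drop_row k n) C' = numB l r (drop_row k n) C') ->
  numA l r n C = numB l r n C.
Proof.
move=> IH; rewrite numA_top_row numB_top_row.
have [g [gE g_lt]] := reversing_map E.
have g_inj : {in E &, injective g}.
  move=> x y xE yE e; case: (ltngtP x y) => [/g_lt|/g_lt|/val_inj //].
    by rewrite e ltnn => /(_ xE yE).
  by rewrite e ltnn => /(_ yE xE).
have g_le x y : x \in E -> y \in E -> (g x <= g y) = (y <= x).
  move=> xE yE; apply/idP/idP; last first.
    by rewrite leq_eqVlt => /orP [/eqP/val_inj ->//|/g_lt lt]; apply/ltnW/lt.
  by apply: contraTT; rewrite -!ltnNge; apply: g_lt.
have g_onto : g @: E = E.
  apply/eqP; rewrite eqEcard card_in_imset // leqnn andbT; apply/subsetP.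
  by move=> _ /imsetP [x xE ->]; apply: gE.
pose rows := [set X | row_ok X].
have gX X : X \in rows -> g @: X \in rows.
  rewrite !inE => /andP [/subsetP sXE cX]; apply/andP; split.
    by apply/subsetP => _ /imsetP [x xX ->]; apply/gE/sXE.
  by rewrite card_in_imset // => x y /sXE xE /sXE; apply: g_inj.
have gX_inj : {in rows &, injective (fun X : {set 'I_w} => g @: X)}.
  move=> X Y; rewrite !inE => /andP [/subsetP sX _] /andP [/subsetP sY _] e.
  apply/setP => x; apply/idP/idP => xX; have := imset_f g xX.
    by rewrite e => /imsetP [y yY /g_inj ->] //; auto.
  by rewrite -e => /imsetP [y yY /g_inj ->] //; auto.
have rows_onto : (fun X : {set 'I_w} => g @: X) @: rows = rows.
  apply/eqP; rewrite eqEcard card_in_imset // leqnn andbT; apply/subsetP.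
  by move=> _ /imsetP [X XR ->]; apply: gX.
transitivity (\sum_(X in rows) numA l r (drop_row k n) (below X)).
  by apply: eq_bigl => X; rewrite inE.
rewrite -{1}rows_onto big_imset //=.
transitivity (\sum_(X in rows) numB l r (drop_row k n) (beyond X)); last first.
  by apply: eq_bigl => X; rewrite inE.
(* After reindexing by the reversal [g] of [E], the inductive hypothesis turns the right side into a
   [delta_2] count too. The two sets of allowed columns agree outside [E] and have equally many
   columns in the range of row [k]. *)
apply: eq_bigr => X; rewrite inE => /andP [/subsetP sXE _]; rewrite -IH.
have rows_le j : 0 < drop_row k n j -> l j <= l k /\ r j = r k.
  rewrite /drop_row; case: eqP => // /eqP jk n_j; split; last exact: ends.
  have jk' : j < k.
    rewrite ltn_neqAle; apply/andP; split=> //.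
    by rewrite leqNgt; apply/negP => /above_k e; rewrite e in n_j.
  by have [] := stair jk' n_j n_k.
have same x : ~~ (l k <= x < r k) -> (x \in below (g @: X)) = (x \in beyond X).
  by move=> xNE; rewrite !inE (negbTE xNE) !andbF.
have cut_eq : [set x in below (g @: X) | l k <= x < r k] =
              g @: [set x in beyond X | l k <= x < r k].
  apply/setP => x; rewrite inE; apply/andP/imsetP => [[xb xlr]|[y]].
    move: xb; rewrite inE => /andP [xC /implyP xle].
    have xE : x \in E by rewrite inE xC.
    move: (xE); rewrite -g_onto => /imsetP [y yE xy]; exists y => //.
    move: (yE); rewrite inE => /andP [yC ylr]; rewrite inE ylr andbT inE yC yE /=.
    apply/forallP => z; apply/implyP => zX; rewrite -(g_le _ _ yE (sXE z zX)) -xy.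
    by have /forallP /(_ (g z)) := xle xE; rewrite imset_f.
  rewrite inE => /andP [yb ylr] ->; move: yb; rewrite inE => /andP [yC /implyP yle].
  have yE : y \in E by rewrite inE yC.
  have gyE := gE y yE; move: (gyE); rewrite inE => /andP [gyC ->]; split=> //.
  rewrite inE gyC gyE /=; apply/forallP => z; apply/implyP => /imsetP [t tX ->].
  by rewrite (g_le _ _ yE (sXE t tX)); have /forallP /(_ t) := yle yE; rewrite tX.
have cut_card : #|[set x in below (g @: X) | l k <= x < r k]| =
                #|[set x in beyond X | l k <= x < r k]|.
  rewrite cut_eq card_in_imset // => x y; rewrite !inE.
  by move=> /andP [/andP [xC _] xlr] /andP [/andP [yC _] ylr]; 
  apply: g_inj; rewrite inE ?xC ?yC.
apply/eqP; rewrite eqn_leq; apply/andP; split;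
  apply: (leq_numA_above rows_le) => [x xN|]; rewrite ?cut_card ?same //.
Qed.

End EqualEnds.

Lemma ltn_sum_at (T : finType) (a b : T -> nat) (t : T) :
  (forall u, a u <= b u) -> a t < b t -> \sum_u a u < \sum_u b u.
Proof.
move=> le_ab lt_t; rewrite (bigD1 t) //= [X in _ < X](bigD1 t) //=.
by rewrite -addSn; apply: leq_add => //; apply: leq_sum.
Qed.

Theorem numA_numB m w (l r n : 'I_m -> nat) (C : {set 'I_w}) :
  staircase l r n -> (forall j, r j <= w) -> numA l r n C = numB l r n C.
Proof.
have [N1] := ubnP (\sum_j n j); elim: N1 => // N1 IHn in r n C *.
have [N2] := ubnP (\sum_j r j); elim: N2 => // N2 IHr in r n C *.
move=> lt_r lt_n stair r_w.
have IH r0 n0 (C0 : {set 'I_w}) h : (forall j, n0 j <= n j) -> n0 h < n h ->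
    staircase l r0 n0 -> (forall j, r0 j <= w) -> numA l r0 n0 C0 = numB l r0 n0 C0.
  move=> le_n lt_h st0 r0_w; apply: IHn => //; rewrite ltnS in lt_n.
  apply: leq_trans lt_n.
  exact: ltn_sum_at lt_h.
pose drop_at (i : 'I_m) := [exists h : 'I_m, [&& h < i, 0 < n h, 0 < n i & r h < r i]].
have stair_sub r0 n0 : (forall j, n0 j <= n j) -> (forall j k : 'I_m, j < k ->
    0 < n0 j -> 0 < n0 k -> r j <= r k -> r0 j <= r0 k) -> staircase l r0 n0.
  move=> le_n le_r j k jk nj nk.
  have [lS rS] := stair j k jk (leq_trans nj (le_n j)) (leq_trans nk (le_n k)).
  by split=> //; apply: le_r.
case: (pickP drop_at) => [i0 drop_i0|no_drop]; last first.
  (* Without 1-cells every filling avoids everything. Otherwise the highest nonempty row is split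
     off; as no row ends later than a nonempty row below it, the right ends coincide. *)
  case: (pickP (fun j => 0 < n j)) => [k0 n_k0|n0]; last first.
    apply: eq_card => f; rewrite !inE; case: (boolP (fits l r n C f)) => //= fitf.
    have none (j : 'I_m) x : x \in f j -> False by move/(fits_gt0 fitf); rewrite n0.
    have -> : delta_free f by apply/delta_freeP => i k x y _ /none.
    symmetry; apply/andP; split; first by apply/iota_freeP => i k x y _ /none.
    by apply/D_freeP => i j k x y z _ _ /none.
  case: (@arg_maxnP _ k0 (fun j => 0 < n j) (fun j => j : nat) n_k0) => k n_k max_k.
  have above_k (j : 'I_m) : k < j -> n j = 0.
    by move=> kj; apply/eqP; rewrite -leqn0 leqNgt; apply/negP => /max_k /=;
    rewrite leqNgt kj.
  apply: (num_top_row C above_k n_k stair) => [j n_j|C'].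
    have /= := max_k j n_j; rewrite leq_eqVlt => /orP [/eqP /val_inj -> //|jk].
    apply/eqP; rewrite eqn_leq; have [_ ->] := stair _ _ jk n_j n_k.
    rewrite leqNgt; apply/negP => lt_rjk; have /existsP := no_drop k; case.
    by exists j; rewrite jk n_j n_k.
  have le_n j : drop_row k n j <= n j by rewrite /drop_row; case: eqP.
  apply: (IH r _ C' k) => //; first by rewrite /drop_row eqxx.
  exact: stair_sub.
(* [drop_at] asks for one shorter row only; minimality of [i] makes all nonempty rows below it end
   before its last cell. *)
case: (@arg_minnP _ i0 drop_at (fun j => j : nat) drop_i0) => i /existsP [h].
case/and4P=> hi n_h n_i rhi min_i.
have r_i : r i = ((r i).-1).+1 by rewrite prednK // (leq_trans _ rhi).
have lt_c : (r i).-1 < w by rewrite -r_i.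
pose c := Ordinal lt_c.
have low (j : 'I_m) : j < i -> 0 < n j -> r j <= c.
  move=> ji n_j; rewrite -ltnS -r_i.
  case: (ltngtP j h) => [jh|hj|/val_inj -> //].
    by have [_ le_r] := stair _ _ jh n_j n_h; apply: leq_ltn_trans rhi.
  have [_ le_r] := stair _ _ hj n_h n_j; apply: leq_ltn_trans rhi.
  rewrite leqNgt; apply/negP => lt_r'; have: drop_at j.
    by apply/existsP; exists h; rewrite hj n_h n_j.
  by move/min_i => /=; rewrite leqNgt ji.
have le_short j : shorten_row i c r j <= r j.
  by rewrite /shorten_row; case: eqP => // ->; rewrite leq_pred.
have short_w j : shorten_row i c r j <= w := leq_trans (le_short j) (r_w j).
have from_le j : rows_from i n j <= n j by rewrite /rows_from; case: ifP.
have from_lt : rows_from i n h < n h by rewrite /rows_from hi.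
have upto_le j : rows_upto i n j <= n j.
  by rewrite /rows_upto; case: ifP => // _; case: eqP => // ->; rewrite leq_pred.
have short_mono (j k : 'I_m) : j < k -> 0 < n j -> r j <= r k ->
    shorten_row i c r j <= shorten_row i c r k.
  move=> jk n_j le_r; rewrite [X in _ <= X]/shorten_row; case: eqP => [e|_].
    by rewrite /shorten_row; case: eqP => // _; apply: low => //; rewrite -e.
  exact: leq_trans (le_short j) le_r.
(* The upper parts lose the 1-cells of row [h] and the lower part one 1-cell of row [i]; the last
   case keeps all 1-cells but has a smaller shape. *)
apply: (num_corner (c := c) r_i stair n_i low) => [K|K||].
- by apply: (IH _ _ _ h) => //; apply: stair_sub.
- apply: (IH _ _ _ h) => //; apply: stair_sub => // j k jk n_j _.
  exact: short_mono (leq_trans n_j (from_le j)).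
- apply: (IH _ _ _ i) => //; last by apply: stair_sub.
  by rewrite /rows_upto ltnn eqxx prednK.
- apply: IHr => //.
    rewrite ltnS in lt_r; apply: leq_trans lt_r; apply: (ltn_sum_at (t := i)) => //.
    by rewrite /shorten_row eqxx [X in _ < X]r_i.
  by apply: stair_sub => // j k jk n_j _; apply: short_mono.
Qed.

Import Order.TTheory GRing.Theory Num.Theory.

(** * Bijections from equal fibre sizes *)

Lemma fibrewise_injection (T : finType) (U : eqType) (A B : {set T}) (s : T -> U) :
  (forall u, #|[set x in A | s x == u]| <= #|[set x in B | s x == u]|) ->
  exists f : T -> T, [/\ {in A &, injective f}, {in A, forall x, f x \in B}
                       & {in A, forall x, s (f x) = s x}].
Proof.
move=> leAB.
pose FA u := [set x in A | s x == u]; pose FB u := [set x in B | s x == u].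
(* Elements are matched by their rank in the enumerations of the two fibres. *)
pose f x := nth x (enum (FB (s x))) (index x (enum (FA (s x)))).
have fin x : x \in A -> index x (enum (FA (s x))) < size (enum (FB (s x))).
  move=> xA; rewrite -cardE (leq_trans _ (leAB _)) // cardE index_mem mem_enum.
  by rewrite inE xA eqxx.
have fFB x : x \in A -> f x \in FB (s x).
  by move=> xA; rewrite -mem_enum; apply/mem_nth/fin.
have fs : {in A, forall x, s (f x) = s x}.
  by move=> x /fFB; rewrite inE => /andP [_ /eqP].
have finj : {in A &, injective f}.
  move=> x y xA yA e; have es : s x = s y by rewrite -fs // e fs.
  move: e; rewrite /f -es => e.
  have yi : index y (enum (FA (s x))) < size (enum (FB (s x))).
    by rewrite {1 2}es; apply: fin.
  move: e; rewrite (set_nth_default x (s := enum (FB (s x))) y) // => /eqP.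
  rewrite nth_uniq ?enum_uniq ?fin // => /eqP e.
  by apply: (index_inj x (s := enum (FA (s x)))) e; rewrite mem_enum inE ?xA ?yA ?es eqxx.
by exists f; split=> // x /fFB; rewrite inE => /andP [].
Qed.

Lemma fibrewise_bijection (T : finType) (U : eqType) (A B : {set T}) (s : T -> U) :
  (forall u, #|[set x in A | s x == u]| = #|[set x in B | s x == u]|) ->
  exists f : T -> T, [/\ {in A &, injective f}, f @: A = B
                       & {in A, forall x, s (f x) = s x}].
Proof.
move=> eqAB.
have [|f [finj fB fs]] := @fibrewise_injection T U A B s; first by move=> u; rewrite eqAB.
have [|g [ginj gA _]] := @fibrewise_injection T U B A s; first by move=> u; rewrite eqAB.
exists f; split=> //; apply/eqP; rewrite eqEcard card_in_imset //.
rewrite (leq_card_inj_in ginj gA) andbT; apply/subsetP => _ /imsetP [x xA ->].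
exact: fB.
Qed.

(** * Occurrences of the three patterns *)

Definition cell_at (x j : nat) : cell := (Posz x.+1, Posz j.+1).

(** Row and column choices become functions on natural numbers, so that concrete patterns can be
    treated by cases without ordinals bounded by [width T] and [height T]. *)
Lemma containsP (S T : cell_shape) (phi : filling S) (psi : filling T) :
  reflect (exists c r : nat -> nat,
    [/\ (forall i k, i < k -> k < width T -> c i < c k),
        (forall i k, i < k -> k < height T -> r i < r k),
        (forall i, i < width T -> c i < width S),
        (forall j, j < height T -> r j < height S) &
        forall i j, i < width T -> j < height T ->
          (cell_at i j \in T) = (cell_at (c i) (r j) \in S) /\
          (cell_at i j \in T -> value psi (cell_at i j) ->
             value phi (cell_at (c i) (r j)))])
    (contains phi psi).
Proof.
apply: (iffP existsP) => [[c /existsP [r /andP []]]|[c [r [c_lt r_lt c_w r_h occ]]]].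
  case/and3P=> /forallP c_lt /forallP r_lt /forallP occ /forallP le.
  pose c' i := oapp (fun k => c k : nat) 0 (insub i).
  pose r' j := oapp (fun k => r k : nat) 0 (insub j).
  have cE i (p : i < width T) : c' i = c (Ordinal p) by rewrite /c' insubT.
  have rE j (p : j < height T) : r' j = r (Ordinal p) by rewrite /r' insubT.
  exists c', r'; split.
  - move=> i k ik kT; have iT := ltn_trans ik kT; rewrite (cE i iT) (cE k kT).
    by have /forallP /(_ (Ordinal kT)) := c_lt (Ordinal iT); rewrite ik.
  - move=> i k ik kT; have iT := ltn_trans ik kT; rewrite (rE i iT) (rE k kT).
    by have /forallP /(_ (Ordinal kT)) := r_lt (Ordinal iT); rewrite ik.
  - by move=> i iT; rewrite (cE i iT).
  - by move=> i iT; rewrite (rE i iT).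
  - move=> i j iT jT; rewrite (cE i iT) (rE j jT).
    have /forallP /(_ (Ordinal jT)) /eqP occ' := occ (Ordinal iT).
    have /forallP /(_ (Ordinal jT)) /implyP le' := le (Ordinal iT).
    split=> // xT px; have := le' xT; rewrite /cell_of in px *.
    by move: px; rewrite /cell_at /= => ->; case: (value phi _).
pose c' : {ffun 'I_(width T) -> 'I_(width S)} :=
  [ffun k : 'I_(width T) => Ordinal (c_w k (ltn_ord k))].
pose r' : {ffun 'I_(height T) -> 'I_(height S)} :=
  [ffun k : 'I_(height T) => Ordinal (r_h k (ltn_ord k))].
exists c'; apply/existsP; exists r'; apply/andP; split; [apply/and3P; split|].
- apply/forallP => i; apply/forallP => k; apply/implyP => ik; rewrite !ffunE /=.
  exact: c_lt.
- apply/forallP => i; apply/forallP => k; apply/implyP => ik; rewrite !ffunE /=.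
  exact: r_lt.
- apply/forallP => i; apply/forallP => j; rewrite /cell_of !ffunE /=.
  by have [e _] := occ i j (ltn_ord i) (ltn_ord j); apply/eqP.
- apply/forallP => i; apply/forallP => j; apply/implyP; rewrite /cell_of !ffunE /= => xT.
  have [_ le] := occ i j (ltn_ord i) (ltn_ord j); move: (le xT); rewrite /cell_at.
  by case: (value psi _) => // ->.
Qed.

Lemma value_val (S : cell_shape) (phi : filling S) (x : S) : value phi (val x) = phi x.
Proof. by rewrite /value valK. Qed.

Lemma value_in (S : cell_shape) (phi : filling S) x : value phi x -> x \in S.
Proof. by rewrite /value; case: insubP. Qed.

Lemma value_ones (S : cell_shape) s x :
  value (filling_of_ones S s) x = (x \in S) && (x \in s).
Proof.
rewrite /value; case: insubP => [y yS <-|/negbTE ->] //=.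
by rewrite ffunE fsvalP.
Qed.

Lemma in_square n (i j : nat) : (cell_at i j \in square n) = (i < n) && (j < n).
Proof.
apply/imfset2P/andP => /= [[a]|[ilt jlt]].
  by rewrite mem_iota => /= ha [b]; rewrite mem_iota => hb [-> ->]; lia.
by exists i.+1; rewrite ?mem_iota; [lia | exists j.+1; rewrite ?mem_iota //; lia].
Qed.

Lemma square_cell n x : x \in square n -> exists i j : nat, x = cell_at i j.
Proof.
case/imfset2P=> /= a; rewrite mem_iota => ha [b]; rewrite mem_iota => hb ->.
by exists a.-1, b.-1; rewrite /cell_at !prednK //; lia.
Qed.

Lemma width_eq (T : cell_shape) n :
  (forall x, x \in T -> `|x.1|%N <= n) -> (exists2 x, x \in T & `|x.1|%N = n) ->
  width T = n.
Proof.
move=> le_n [x xT xn]; apply/eqP; rewrite eqn_leq; apply/andP; split.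
  by apply/bigmax_leqP_seq => y yT _; apply: le_n.
by rewrite -xn; apply: (leq_bigmax_seq (F := fun x : cell => `|x.1|%N)).
Qed.

Lemma height_eq (T : cell_shape) n :
  (forall x, x \in T -> `|x.2|%N <= n) -> (exists2 x, x \in T & `|x.2|%N = n) ->
  height T = n.
Proof.
move=> le_n [x xT xn]; apply/eqP; rewrite eqn_leq; apply/andP; split.
  by apply/bigmax_leqP_seq => y yT _; apply: le_n.
by rewrite -xn; apply: (leq_bigmax_seq (F := fun x : cell => `|x.2|%N)).
Qed.

Lemma width_square n : width (square n.+1) = n.+1.
Proof.
apply: width_eq => [x xT|].
  by have [i [j e]] := square_cell xT; move: xT; rewrite e in_square => /andP [].
by exists (cell_at n n); rewrite ?in_square ?ltnSn.
Qed.

Lemma height_square n : height (square n.+1) = n.+1.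
Proof.
apply: height_eq => [x xT|].
  by have [i [j e]] := square_cell xT; move: xT; rewrite e in_square => /andP [].
by exists (cell_at n n); rewrite ?in_square ?ltnSn.
Qed.

Lemma in_shapeD (i j : nat) : (cell_at i j \in shapeD) =
  [&& i < 3, j < 3, ~~ ((i == 0) && (j == 2)) & ~~ ((i == 2) && (j == 0))].
Proof.
rewrite in_fsetD in_square !inE /cell_at !xpair_eqE negb_or.
have e (a b : nat) : (Posz a.+1 == Posz b.+1) = (a == b) by [].
by rewrite !(e _ 0) !(e _ 2) andbC -andbA.
Qed.

Lemma width_shapeD : width shapeD = 3.
Proof.
apply: width_eq => [x|].
  rewrite in_fsetD => /andP [_ xT].
  by have [i [j e]] := square_cell xT; move: xT; rewrite e in_square => /andP [].
by exists (cell_at 2 2); rewrite ?in_shapeD.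
Qed.

Lemma height_shapeD : height shapeD = 3.
Proof.
apply: height_eq => [x|].
  rewrite in_fsetD => /andP [_ xT].
  by have [i [j e]] := square_cell xT; move: xT; rewrite e in_square => /andP [].
by exists (cell_at 2 2); rewrite ?in_shapeD.
Qed.

(** Only two corners are required to be cells of [S]; the other two carry 1-cells, and [value] is
    false outside [S]. *)
Lemma contains_delta2P (S : cell_shape) (phi : filling S) :
  reflect (exists x y h k : nat,
    [/\ [/\ x < y, h < k, y < width S & k < height S],
        cell_at x h \in S, cell_at y k \in S,
        value phi (cell_at x k) & value phi (cell_at y h)])
    (contains phi delta2).
Proof.
have v i j : value delta2 (cell_at i j) = ((i, j) == (0, 1)) || ((i, j) == (1, 0)).
  rewrite value_ones in_square !inE; case: i j => [|[|i]] [|[|j]] //.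
apply: (iffP (containsP _ _)); rewrite width_square height_square.
  case=> c [r [c_lt r_lt c_w r_h occ]].
  exists (c 0), (c 1), (r 0), (r 1); split.
  - by split; auto.
  - by have [<- _] := occ 0 0 isT isT; rewrite in_square.
  - by have [<- _] := occ 1 1 isT isT; rewrite in_square.
  - by have [_] := occ 0 1 isT isT; rewrite in_square v; apply.
  - by have [_] := occ 1 0 isT isT; rewrite in_square v; apply.
case=> x [y [h [k [[xy hk yS kS] xhS ykS vxk vyh]]]].
exists (fun i => if i == 0 then x else y), (fun j => if j == 0 then h else k); split.
- by move=> [|i] [|[|j]].
- by move=> [|i] [|[|j]].
- by move=> [|i] _ //=; apply: ltn_trans yS.
- by move=> [|i] _ //=; apply: ltn_trans kS.
- move=> [|[|i]] [|[|j]] // _ _; rewrite in_square v /=; split=> //.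
  + by rewrite (value_in vxk).
  + by rewrite (value_in vyh).
Qed.

Lemma contains_iota2P (S : cell_shape) (phi : filling S) :
  reflect (exists x y h k : nat,
    [/\ [/\ x < y, h < k, y < width S & k < height S],
        cell_at x k \in S, cell_at y h \in S,
        value phi (cell_at x h) & value phi (cell_at y k)])
    (contains phi iota2).
Proof.
have v i j : value iota2 (cell_at i j) = ((i, j) == (0, 0)) || ((i, j) == (1, 1)).
  rewrite value_ones in_square !inE; case: i j => [|[|i]] [|[|j]] //.
apply: (iffP (containsP _ _)); rewrite width_square height_square.
  case=> c [r [c_lt r_lt c_w r_h occ]].
  exists (c 0), (c 1), (r 0), (r 1); split.
  - by split; auto.
  - by have [<- _] := occ 0 1 isT isT; rewrite in_square.
  - by have [<- _] := occ 1 0 isT isT; rewrite in_square.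
  - by have [_] := occ 0 0 isT isT; rewrite in_square v; apply.
  - by have [_] := occ 1 1 isT isT; rewrite in_square v; apply.
case=> x [y [h [k [[xy hk yS kS] xhS ykS vxk vyh]]]].
exists (fun i => if i == 0 then x else y), (fun j => if j == 0 then h else k); split.
- by move=> [|i] [|[|j]].
- by move=> [|i] [|[|j]].
- by move=> [|i] _ //=; apply: ltn_trans yS.
- by move=> [|i] _ //=; apply: ltn_trans kS.
- move=> [|[|i]] [|[|j]] // _ _; rewrite in_square v /=; split=> //.
  + by rewrite (value_in vxk).
  + by rewrite (value_in vyh).
Qed.

Lemma contains_phiDP (S : cell_shape) (phi : filling S) :
  reflect (exists x y z i j k : nat,
    [/\ [/\ x < y, y < z & z < width S], [/\ i < j, j < k & k < height S],
        [/\ cell_at x k \notin S, cell_at z i \notin S,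
            cell_at x j \in S & cell_at y i \in S],
        cell_at y j \in S /\ cell_at z k \in S &
        [/\ value phi (cell_at x i), value phi (cell_at y k) &
            value phi (cell_at z j)]])
    (contains phi phiD).
Proof.
have v i j : value phiD (cell_at i j) =
    [|| (i, j) == (0, 0), (i, j) == (1, 2) | (i, j) == (2, 1)].
  rewrite value_ones in_shapeD !inE; case: i j => [|[|[|i]]] [|[|[|j]]] //.
apply: (iffP (containsP _ _)); rewrite width_shapeD height_shapeD.
  case=> c [r [c_lt r_lt c_w r_h occ]].
  exists (c 0), (c 1), (c 2), (r 0), (r 1), (r 2); split.
  - by split; auto.
  - by split; auto.
  - split.
    + by have [<- _] := occ 0 2 isT isT; rewrite in_shapeD.
    + by have [<- _] := occ 2 0 isT isT; rewrite in_shapeD.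
    + by have [<- _] := occ 0 1 isT isT; rewrite in_shapeD.
    + by have [<- _] := occ 1 0 isT isT; rewrite in_shapeD.
  - split.
    + by have [<- _] := occ 1 1 isT isT; rewrite in_shapeD.
    + by have [<- _] := occ 2 2 isT isT; rewrite in_shapeD.
  - split.
    + by have [_] := occ 0 0 isT isT; rewrite in_shapeD v; apply.
    + by have [_] := occ 1 2 isT isT; rewrite in_shapeD v; apply.
    + by have [_] := occ 2 1 isT isT; rewrite in_shapeD v; apply.
case=> x [y [z [i [j [k [[xy yz zS] [ij jk kS] [/negbTE xk /negbTE zi xj yi]]]]]]].
case=> yj zk [vxi vyk vzj].
(* The default of [nth] supplies the third column and the third row. *)
exists (fun a => nth z [:: x; y] a), (fun a => nth k [:: i; j] a); split.
- by move=> [|[|a]] [|[|[|b]]] //= _ _; apply: ltn_trans yz.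
- by move=> [|[|a]] [|[|[|b]]] //= _ _; apply: ltn_trans jk.
- by move=> [|[|[|a]]] _ //=; lia.
- by move=> [|[|[|a]]] _ //=; lia.
- move=> [|[|[|a]]] [|[|[|b]]] // _ _; rewrite in_shapeD v /=; split=> //.
  + by rewrite (value_in vxi).
  + by rewrite (value_in vyk).
  + by rewrite (value_in vzj).
Qed.

(** * From skew shapes to staircases *)

Section SkewShape.

Variable S : cell_shape.
Hypotheses (skewS : skew_shape S) (stdS : standard_position S).

Notation w := (width S).
Notation m := (height S).

(** If the middle cell were in [F2], so would be the first cell of its row, and row convexity would
    put the left cell into [F2] as well. *)
Let cells_in_row (x y z j : nat) : x <= y <= z ->
  cell_at x j \in S -> cell_at z j \in S -> cell_at y j \in S.
Proof.
have [a [b [F1 [F2 [[row1 _ left1 _] [row2 _ left2 _] ->]]]]] := skewS.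
move=> xyz; rewrite !in_fsetD => /andP [xN x1] /andP [_ z1]; apply/andP; split.
  apply: contra xN => y2; have [_ a2] := left2 _ _ y2.
  have [a_le _] := left1 _ _ x1.
  by apply: (row2 a _ (Posz y.+1)) => //; lia.
by apply: (row1 (Posz x.+1) _ (Posz z.+1)) => //; lia.
Qed.

(** The corners lie in [F1] by convexity towards column [a] and row [b]. If one of them were in
    [F2], the same convexity would put the upper left cell into [F2]. *)
Let corners (x y h k : nat) : y <= x -> h <= k ->
  cell_at y k \in S -> cell_at x h \in S -> cell_at y h \in S /\ cell_at x k \in S.
Proof.
have [a [b [F1 [F2 [[row1 col1 left1 top1] [row2 col2 left2 top2] ->]]]]] := skewS.
move=> yx hk; rewrite !in_fsetD => /andP [ykN yk1] /andP [xhN xh1].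
have [a_le ah1] := left1 _ _ xh1; have [a_le' ak1] := left1 _ _ yk1.
have [b_ge xb1] := top1 _ _ xh1; have [b_ge' yb1] := top1 _ _ yk1.
split; apply/andP; split.
- apply: contra ykN => yh2; have [_ yb2] := top2 _ _ yh2.
  by apply: (col2 _ (Posz h.+1) _ b) => //; lia.
- by apply: (row1 a _ (Posz x.+1)) => //; lia.
- apply: contra ykN => xk2; have [_ ak2] := left2 _ _ xk2.
  by apply: (row2 a _ (Posz x.+1)) => //; lia.
- by apply: (col1 _ (Posz h.+1) _ b) => //; lia.
Qed.

Let cell_bounds c : c \in S -> exists (x : 'I_w) (j : 'I_m), c = cell_at x j.
Proof.
case: c => i j cS; have [i1 j1] := stdS.1 _ _ cS.
have i_w : `|i|%N <= w by apply: (leq_bigmax_seq (F := fun x : cell => `|x.1|%N) (i, j)).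
have j_m : `|j|%N <= m by apply: (leq_bigmax_seq (F := fun x : cell => `|x.2|%N) (i, j)).
have i_lt : `|i|%N.-1 < w by lia.
have j_lt : `|j|%N.-1 < m by lia.
by exists (Ordinal i_lt), (Ordinal j_lt); rewrite /cell_at /= !prednK; [congr pair|..]; lia.
Qed.

(** The minimum is written through a maximum. An empty row gets left end [w] and right end 0, which
    is why monotonicity is claimed for nonempty rows only. *)
Let row_left (j : 'I_m) : nat := w - \max_(x < w | cell_at x j \in S) (w - x).
Let row_right (j : 'I_m) : nat := \max_(x < w | cell_at x j \in S) x.+1.

Let row_nonempty (j : 'I_m) := [exists x : 'I_w, cell_at x j \in S].

Let row_ends (j : 'I_m) : row_nonempty j -> exists a b : 'I_w,
  [/\ cell_at a j \in S, cell_at b j \in S, row_left j = a & row_right j = b.+1].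
Proof.
move=> /existsP [x xS].
have ne : 0 < #|[pred x : 'I_w | cell_at x j \in S]| by apply/card_gt0P; exists x.
have [a aS ea] := eq_bigmax_cond (fun x : 'I_w => w - x) ne.
have [b bS eb] := eq_bigmax_cond (fun x : 'I_w => x.+1) ne.
exists a, b; split=> //.
by rewrite /row_left ea; have := ltn_ord a; lia.
Qed.

Let in_row (x : 'I_w) (j : 'I_m) :
  (cell_at x j \in S) = (row_left j <= x < row_right j).
Proof.
apply/idP/idP => [xS|/andP [lx xr]].
  apply/andP; split.
    have := leq_bigmax_cond (F := fun x : 'I_w => w - x)
                            (P := fun x : 'I_w => cell_at x j \in S) x xS.
    by rewrite /= /row_left !leq_subLR addnC.
  exact: (leq_bigmax_cond (F := fun x : 'I_w => x.+1)
                          (P := fun x : 'I_w => cell_at x j \in S) x xS).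
have ne : row_nonempty j.
  apply: contraLR xr => /existsPn none; rewrite -leqNgt /row_right big_pred0 // => y.
  exact/negbTE.
have [a [b [aS bS ea eb]]] := row_ends ne.
by apply: (cells_in_row (x := a) (z := b)) => //; lia.
Qed.

Let row_right_le j : row_right j <= w.
Proof. by apply/bigmax_leqP => x _. Qed.

Let staircase_ends (h k : 'I_m) : h < k -> row_nonempty h -> row_nonempty k ->
  row_left h <= row_left k /\ row_right h <= row_right k.
Proof.
move=> hk /row_ends [a [b [aS bS ea0 ->]]] /row_ends [a' [b' [aS' bS' ea eb]]].
split; rewrite ?ea0 ?ea ?eb.
  rewrite leqNgt; apply/negP => lt_a.
  have [a'h _] := corners (ltnW lt_a) (ltnW hk) aS' aS.
  by move: a'h; rewrite in_row ea0 leqNgt lt_a.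
rewrite ltnS leqNgt; apply/negP => lt_b.
have [_ bk] := corners (ltnW lt_b) (ltnW hk) bS' bS.
by move: bk; rewrite in_row eb => /andP [_]; rewrite ltnNge lt_b.
Qed.

(** * Translation of fillings of the shape into grids *)

Let to_grid (phi : filling S) : grid m w :=
  [ffun j : 'I_m => [set x : 'I_w | value phi (cell_at x j)]].
Let of_grid (g : grid m w) : filling S :=
  [ffun c : S => [exists x : 'I_w, exists j : 'I_m,
     (val c == cell_at x j) && (x \in g j)]].

Let mem_grid phi (j : 'I_m) (x : 'I_w) : (x \in to_grid phi j) = value phi (cell_at x j).
Proof. by rewrite ffunE inE. Qed.

Let grid_row phi (j : 'I_m) (x : 'I_w) :
  x \in to_grid phi j -> row_left j <= x < row_right j.
Proof. by rewrite mem_grid -in_row => /value_in. Qed.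

Let grid_nonempty phi (j : 'I_m) (x : 'I_w) : x \in to_grid phi j -> row_nonempty j.
Proof. by rewrite mem_grid => /value_in xS; apply/existsP; exists x. Qed.

Let of_gridK : cancel to_grid of_grid.
Proof.
move=> phi; apply/ffunP => c; rewrite ffunE -value_val.
apply/existsP/idP => [[x /existsP [j /andP [/eqP ->]]]|]; first by rewrite mem_grid.
have [x [j e]] := cell_bounds (fsvalP c); rewrite [val c]e => xj.
by exists x; apply/existsP; exists j; rewrite eqxx mem_grid.
Qed.

Let to_gridK n g : fits row_left row_right n [set: 'I_w] g -> to_grid (of_grid g) = g.
Proof.
case/fitsP=> mem _; apply/ffunP => j; apply/setP => x; rewrite mem_grid.
apply/idP/idP => [|xj].
  rewrite /value; case: insubP => // c cS cE; rewrite ffunE.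
  case/existsP=> y /existsP [k /andP [/eqP]]; rewrite cE => -[exy ejk] yk.
  by have -> : x = y by [apply/val_inj]; have -> : j = k by [apply/val_inj].
have xS : cell_at x j \in S by have [_ lx xr] := mem _ _ xj; rewrite in_row lx.
have -> : cell_at x j = val (FSetSub xS) by [].
rewrite value_val ffunE; apply/existsP; exists x; apply/existsP; exists j.
by rewrite eqxx.
Qed.

Let avoids_delta2 phi : avoids phi delta2 = delta_free (to_grid phi).
Proof.
apply/negP/delta_freeP => [H i k x y ik xi yk|H /contains_delta2P].
  rewrite leqNgt; apply/negP => yx; apply: H; apply/contains_delta2P.
  rewrite !mem_grid in xi yk; exists y, x, i, k.
  by have [] := corners (ltnW yx) (ltnW ik) (value_in yk) (value_in xi).
case=> x [y [h [k [[xy hk yw km] _ _ xk yh]]]].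
have xw := ltn_trans xy yw; have hm := ltn_trans hk km.
have := H (Ordinal hm) (Ordinal km) (Ordinal yw) (Ordinal xw) hk.
by rewrite !mem_grid /= => /(_ yh xk); rewrite leqNgt xy.
Qed.

Let avoids_iota2 phi : avoids phi iota2 = iota_free row_left row_right (to_grid phi).
Proof.
apply/negP/iota_freeP => [H i k x y ik xi yk lx xy yr|H /contains_iota2P].
  apply: H; apply/contains_iota2P; exists x, y, i, k.
  have /andP [lx' xr'] := grid_row xi; have /andP [ly' yr'] := grid_row yk.
  rewrite !mem_grid in xi yk; split=> //; rewrite ?in_row.
  - by rewrite lx (ltn_trans xy).
  - by rewrite yr (leq_trans lx' (ltnW xy)).
case=> x [y [h [k [[xy hk yw km] xk yh xh yk]]]].
have xw := ltn_trans xy yw; have hm := ltn_trans hk km.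
apply: (H (Ordinal hm) (Ordinal km) (Ordinal xw) (Ordinal yw) hk) => //.
- by rewrite mem_grid.
- by rewrite mem_grid.
- by have := in_row (Ordinal xw) (Ordinal km); rewrite xk => /esym /andP [].
- by have := in_row (Ordinal yw) (Ordinal hm); rewrite yh => /esym /andP [].
Qed.

Let avoids_phiD phi : avoids phi phiD = D_free row_left row_right (to_grid phi).
Proof.
apply/negP/D_freeP => [H i j k x y z ij jk xi yk zj lx xl yr rz|H /contains_phiDP].
  have /andP [lxi xri] := grid_row xi; have /andP [lyk yrk] := grid_row yk.
  have /andP [lzj zrj] := grid_row zj.
  have [_ rjk] := staircase_ends jk (grid_nonempty zj) (grid_nonempty yk).
  rewrite !mem_grid in xi yk zj.
  apply: H; apply/contains_phiDP; exists x, y, z, i, j, k.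
  have xy : x < y := leq_trans xl lyk; have yz : y < z := leq_trans yr rz.
  split=> //; split=> //; rewrite ?in_row; lia.
case=> x [y [z [i [j [k [[xy yz zw] [ij jk km] [xkN ziN xj yi] [yj zk] [xi yk zj]]]]]]].
have yw := ltn_trans yz zw; have xw := ltn_trans xy yw.
have jm := ltn_trans jk km; have im := ltn_trans ij jm.
have := in_row (Ordinal xw) (Ordinal km); rewrite (negbTE xkN) /= => /esym xkN'.
have := in_row (Ordinal zw) (Ordinal im); rewrite (negbTE ziN) /= => /esym ziN'.
have := in_row (Ordinal xw) (Ordinal jm); rewrite xj /= => /esym /andP [lxj xrj].
have := in_row (Ordinal yw) (Ordinal im); rewrite yi /= => /esym /andP [lyi yri].
have := in_row (Ordinal xw) (Ordinal im); rewrite (value_in xi) /= => /esym /andP [lxi xri].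
have := in_row (Ordinal yw) (Ordinal km); rewrite (value_in yk) /= => /esym /andP [lyk yrk].
apply: (H (Ordinal im) (Ordinal jm) (Ordinal km) (Ordinal xw) (Ordinal yw) (Ordinal zw)) => //.
- by rewrite mem_grid.
- by rewrite mem_grid.
- by rewrite mem_grid.
- by rewrite ltnNge; apply/negP => lkx; move: xkN'; rewrite lkx (ltn_trans xy yrk).
- rewrite leqNgt; apply/negP => zr; move: ziN'; rewrite zr andbT => /negP; apply.
  exact: leq_trans lyi (ltnW yz).
Qed.

Let ones_grid phi (j : 'I_m) : ones_in_row phi (Posz j.+1) = #|to_grid phi j|.
Proof.
pose fiber := [set c : S | phi c && ((val c).2 == Posz j.+1)].
pose cell_in (x : 'I_w) : option S := insub (cell_at x j).
have cell_inP (x : 'I_w) : x \in to_grid phi j ->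
    exists2 c : S, cell_in x = Some c & val c = cell_at x j.
  rewrite mem_grid => /value_in xS; exists (FSetSub xS) => //.
  by rewrite /cell_in insubT.
have some_inj : injective (@Some S) by move=> c d [].
rewrite -[LHS](card_imset fiber some_inj) -(card_in_imset (f := cell_in)).
  apply: eq_card => u; apply/imsetP/imsetP => [[c]|[x xj ->]].
    rewrite inE => /andP [phic /eqP cj] ->.
    have [x [k e]] := cell_bounds (fsvalP c).
    have kj : k = j by apply/val_inj; move: cj; rewrite [val c]e => -[].
    rewrite kj in e; exists x; first by rewrite mem_grid -[cell_at x j]e value_val.
    by rewrite /cell_in -[cell_at x j]e valK.
  have [c -> cE] := cell_inP x xj; exists c => //.
  by rewrite inE cE eqxx -value_val cE -mem_grid xj.
move=> x y /cell_inP [c -> cE] /cell_inP [d -> dE] [e].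
by apply/val_inj; move: cE; rewrite e dE => -[].
Qed.

Let ones_outside (phi : filling S) (t : int) :
  (forall j : 'I_m, t <> Posz j.+1) -> ones_in_row phi t = 0.
Proof.
move=> out; apply/eqP; rewrite cards_eq0; apply/eqP/setP => c; rewrite !inE.
apply/negP => /andP [_ /eqP ct]; have [x [j e]] := cell_bounds (fsvalP c).
by case: (out j); rewrite -ct [val c]e.
Qed.

Let row_sums phi : {ffun 'I_m -> nat} := [ffun j => #|to_grid phi j|].

Let card_fibre (free : pred (grid m w)) (n : {ffun 'I_m -> nat}) :
  #|[set phi | free (to_grid phi) && (row_sums phi == n)]| =
  #|[set g | fits row_left row_right n [set: 'I_w] g && free g]|.
Proof.
apply: (card_can_in (f := to_grid) (g := of_grid)).
- move=> phi; rewrite !inE => /andP [-> /eqP <-]; rewrite andbT.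
  apply/fitsP; split=> j; last by rewrite [RHS]ffunE.
  by move=> x /grid_row /andP [lx xr]; rewrite inE.
- move=> g; rewrite !inE => /andP [fitg free_g]; rewrite (to_gridK fitg) free_g /=.
  apply/eqP/ffunP => j; rewrite ffunE (to_gridK fitg).
  by have [_ ->] := fitsP _ _ _ _ _ fitg.
- by move=> phi _; apply: of_gridK.
- by move=> g; rewrite inE => /andP [/to_gridK].
Qed.

Let eq_fibres (n : {ffun 'I_m -> nat}) :
  numA row_left row_right n [set: 'I_w] = numB row_left row_right n [set: 'I_w].
Proof.
(* If [n] asks for 1-cells in an empty row, the staircase condition may fail, but then no filling
   fits. *)
case: (pickP [pred j : 'I_m | (0 < n j) && ~~ row_nonempty j])
  => [j /andP [n_j empty_j]|ne].
  have nofit g : fits row_left row_right n [set: 'I_w] g = false.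
    apply/negP => /fitsP [mem card]; move: n_j; rewrite -card card_gt0.
    case/set0Pn=> x /mem [_ lx xr]; case/existsP: empty_j; exists x.
    by rewrite in_row lx.
  by apply: eq_card => g; rewrite !inE nofit.
apply: numA_numB row_right_le => h k hk n_h n_k.
by apply: staircase_ends => //; apply: contraT => e;
  [have /= := ne h | have /= := ne k]; rewrite ?n_h ?n_k e.
Qed.

(** The fibres of [row_sums] in both classes have equal size, so a bijection can be chosen fibre by
    fibre; rows outside the shape contain no 1-cells. *)
Lemma avoiders_bijection :
  let A := [set phi : filling S | avoids phi delta2] in
  let B := [set phi : filling S | avoids phi iota2 && avoids phi phiD] in
  exists f : filling S -> filling S,
    [/\ {in A &, injective f}, f @: A = B
      & forall phi, phi \in A ->
          forall j : int, ones_in_row (f phi) j = ones_in_row phi j].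
Proof.
move=> A B.
have [n|f [f_inj fAB fs]] := @fibrewise_bijection _ _ A B row_sums.
  transitivity (numA row_left row_right n [set: 'I_w]).
    rewrite /numA -(card_fibre (@delta_free m w)); apply: eq_card => phi.
    by rewrite !inE avoids_delta2.
  rewrite eq_fibres /numB -(card_fibre (B_free row_left row_right)).
  by apply: eq_card => phi; rewrite !inE avoids_iota2 avoids_phiD.
exists f; split=> // phi phiA t.
case: (pickP (fun j : 'I_m => t == Posz j.+1)) => [j /eqP ->|out].
  rewrite !ones_grid; have /ffunP /(_ j) := fs _ phiA; by rewrite !ffunE.
by rewrite !ones_outside // => j /eqP; rewrite out.
Qed.

End SkewShape.

Theorem theorem2p6 (S : cell_shape) :
  skew_shape S -> standard_position S ->
  let A := [set phi : filling S | avoids phi delta2] in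
  let B := [set phi : filling S | avoids phi iota2 && avoids phi phiD] in
  #|A| = #|B| /\
  exists f : filling S -> filling S,
    [/\ {in A &, injective f},
        f @: A = B
      & forall phi, phi \in A ->
          forall j : int, ones_in_row (f phi) j = ones_in_row phi j].
Proof.
move=> skewS stdS A B; have [f [f_inj fAB f_ones]] := avoiders_bijection skewS stdS.
by split; [rewrite -[B]fAB card_in_imset | exists f].
Qed.
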